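(* Let $P$ be the law of the reference regime-switching process, let $\rho\in\mathcal P(\mathbb R^d\times\mathcal I)$ and $\mu_{\mathrm p}\in\mathcal P(\mathbb R^d)$, and let $\bar P_{0,T}:=P\circ(Z_0,X_T)^{-1}$. Assume: (1) $H(\rho\otimes\mu_{\mathrm p}\mid\bar P_{0,T})<\infty$ and $\bar P_{0,T}\big|_{\operatorname{supp}(\rho\otimes\mu_{\mathrm p})}\ll\rho\otimes\mu_{\mathrm p}$. (2) For every $i\in\mathcal I$ with $\bar\rho(i)>0$, the conditional law $\hat\rho_i$ and the measure $\mu_{\mathrm p}$ are absolutely continuous with respect to Lebesgue measure on $\mathbb R^d$. (3) $\rho$ is compactly supported on $\mathbb R^d\times\mathcal I$ and $\mu_{\mathrm p}$ is compactly supported on $\mathbb R^d$. (4) There is $C_{\mu_{\mathrm p}}>0$ with $W_2^2(\eta,\mu_{\mathrm p})\le C_{\mu_{\mathrm p}}H(\eta\mid\mu_{\mathrm p})$ for all $\eta\in\mathcal P(\mathbb R^d)$. (5) The transition kernel of the reference process admits a density $r_{ij}(0,x;T,y)$ and, with $\bar r_i(0,x;T,y):=\sum_{j\in\mathcal I}r_{ij}(0,x;T,y)$, for every $i\in\mathcal I$ with $\bar\rho(i)>0$ the map $(x,y)\mapsto\bar r_i(0,x;T,y)$ is of class $C^2$ and strictly positive on $\operatorname{supp}(\hat\rho_i)\times\operatorname{supp}(\mu_{\mathrm p})$. Let $\gamma^{\rho,\mu_{\mathrm p}}$ be the optimal coupling of the projected static entropic optimal transport problem, and let $\gamma^{n+1,n}$,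 $\gamma^{n+1,n+1}$ ($n\ge0$) be the half-step and full-step couplings generated by the projected Sinkhorn iteration started from a strictly positive function $g^0$. Assume $H(\gamma^{\rho,\mu_{\mathrm p}}\mid\gamma^{1,0})<\infty$ and $H(\gamma^{\rho,\mu_{\mathrm p}}\mid\gamma^{1,1})<\infty$. Then there exist constants $A>0$ and $\theta\in(0,1)$ such that, for all $n\ge0$, $$H(\gamma^{\rho,\mu_{\mathrm p}}\mid\gamma^{n+1,n})\le A\theta^n,\qquad H(\gamma^{\rho,\mu_{\mathrm p}}\mid\gamma^{n+1,n+1})\le A\theta^n.$$ Moreover, let $Q^{n+1,n}$ and $Q^{n+1,n+1}$ be the path measures obtained by lifting $\gamma^{n+1,n}$ and $\gamma^{n+1,n+1}$ while keeping $P(\cdot\mid Z_0,X_T)$ unchanged. Then $$\mathcal H(Q^{\rho,\mu_{\mathrm p}}\mid Q^{n+1,n})=H(\gamma^{\rho,\mu_{\mathrm p}}\mid\gamma^{n+1,n}),\qquad\mathcal H(Q^{\rho,\mu_{\mathrm p}}\mid Q^{n+1,n+1})=H(\gamma^{\rho,\mu_{\mathrm p}}\mid\gamma^{n+1,n+1}),$$ and consequently $$\mathcal H(Q^{\rho,\mu_{\mathrm p}}\mid Q^{n+1,n})\le A\theta^n,\qquad\mathcal H(Q^{\rho,\mu_{\mathrm p}}\mid Q^{n+1,n+1})\le A\theta^n.$$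
   Context: Fix $T>0$, $d\ge1$, a finite set $\mathcal I=\{1,\dots,m\}$, and $E:=\mathbb R^d\times\mathcal I$. Reference process: $Z_t=(X_t,I_t)$, $t\in[0,T]$, is an $E$-valued Markov process with $dX_t=b_{I_t}(t,X_t)\,dt+\sigma_{I_t}(t,X_t)\,dW_t$ ($W$ a $d$-dimensional Brownian motion) and $\mathbb P(I_{t+h}=j\mid I_t=i,X_t=x)=\lambda_{ij}(t,x)h+o(h)$ as $h\downarrow0$ for $j\ne i$, with $b_i:[0,T]\times\mathbb R^d\to\mathbb R^d$, $\sigma_i:[0,T]\times\mathbb R^d\to\mathbb R^{d\times d}$, $\lambda_{ij}:[0,T]\times\mathbb R^d\to\mathbb R_+$ (jumps change only $I$, not $X$). $P$ is its law on $\Omega_T=C([0,T];\mathbb R^d)\times D([0,T];\mathcal I)$. It is assumed that the components $A\mapsto P(X_0\in A,I_0=i)$ of the initial law have Lebesgue densities; the transition density is defined by $P(X_T\in dy,I_T=j\mid X_0=x,I_0=i)=r_{ij}(0,x;T,y)\,dy$. For a measure $\eta$ on $E$: $\eta_i(A):=\eta(A\times\{i\})$, $\bar\eta(i):=\eta_i(\mathbb R^d)$, and, if $\bar\eta(i)>0$, $\hat\eta_i:=\eta_i/\bar\eta(i)$; for a measure $\gamma$ on $E\times\mathbb R^d$, $\gamma_i(A\times B):=\gamma((A\times\{i\})\times B)$. $H$ and $\mathcal H$ denote relative entropy, $H(\alpha\mid\beta)=\int\log\frac{d\alpha}{d\beta}\,d\alpha$ if $\alpha\ll\beta$, $+\infty$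 otherwise ($\mathcal H$ for measures on $\Omega_T$). $W_2$ is the quadratic Wasserstein distance. Projected static problem: with $\bar c_i(x,y):=-\log\bar r_i(0,x;T,y)$, $\gamma^{\rho,\mu_{\mathrm p}}$ is the unique minimizer over couplings $\gamma\in\Pi(\rho,\mu_{\mathrm p})$ on $E\times\mathbb R^d$ of $H(\gamma\mid\rho\otimes\mu_{\mathrm p})+\int\bar c_i(x,y)\,\gamma(d(x,i),dy)$. Projected Sinkhorn iteration: given strictly positive $g^0$ on $\mathbb R^d$, for $n\ge0$ $$f_i^{n+1}(x)=\Bigl(\int_{\mathbb R^d}\bar r_i(0,x;T,y)g^n(y)\,\mu_{\mathrm p}(dy)\Bigr)^{-1},\ i\in\mathcal I,\qquad g^{n+1}(y)=\Bigl(\sum_{i\in\mathcal I}\int_{\mathbb R^d}\bar r_i(0,x;T,y)f_i^{n+1}(x)\,\rho_i(dx)\Bigr)^{-1},$$ $$\gamma_i^{n+1,n}(dx,dy)=f_i^{n+1}(x)\bar r_i(0,x;T,y)g^n(y)\,\rho_i(dx)\mu_{\mathrm p}(dy),$$ $$\gamma_i^{n+1,n+1}(dx,dy)=f_i^{n+1}(x)\bar r_i(0,x;T,y)g^{n+1}(y)\,\rho_i(dx)\mu_{\mathrm p}(dy).$$ Lifting: the lift of a measure $\gamma$ on $E\times\mathbb R^d$ is the path measure $Q$ on $\Omega_T$ with $Q\circ(Z_0,X_T)^{-1}=\gamma$ and $Q(\cdot\mid Z_0,X_T)=P(\cdot\mid Z_0,X_T)$; $Q^{\rho,\mu_{\mathrm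 p}}$ is the lift of $\gamma^{\rho,\mu_{\mathrm p}}$. *)

(* Defs.v *)
From HB Require Import structures.
From mathcomp Require Import all_boot all_order all_algebra.
From mathcomp Require Import all_classical all_reals all_analysis measurable_realfun.
Set Implicit Arguments. Unset Strict Implicit. Unset Printing Implicit Defensive.
Import Order.TTheory GRing.Theory Num.Theory numFieldNormedType.Exports.
Local Open Scope classical_set_scope. Local Open Scope ring_scope.

(* The regime set has m.+1 elements and carries the discrete topology and the
   discrete sigma-algebra. *)
HB.instance Definition _ (m : nat) := isPointed.Build 'I_m.+1 ord0.
HB.instance Definition _ (m : nat) := hasNbhs.Build 'I_m.+1 principal_filter.
HB.instance Definition _ (m : nat) := Discrete_ofNbhs.Build 'I_m.+1 erefl.
HB.instance Definition _ (m : nat) := @isMeasurable.Build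
  default_measure_display 'I_m.+1 discrete_measurable discrete_measurable0
  discrete_measurableC discrete_measurableU.

(* Borel sigma-algebra on matrices, in particular on 'rV[R]_d, which plays the
   role of R^d. *)
HB.instance Definition _ (R : realType) (m n : nat) :=
  Measurable.copy 'M[R]_(m, n) (g_sigma_algebraType (@open 'M[R]_(m, n))).

Section borel_matrix.
Context (R : realType).

Lemma measurable_mx_entry m n (i : 'I_m) (j : 'I_n) :
  measurable_fun [set: 'M[R]_(m, n)] (fun A => A i j).
Proof.
apply: (measurability _ (RGenOpens.measurableE R)).
move=> _ [_ [a [b ->]] <-]; rewrite setTI; apply: sub_sigma_algebra.
have : continuous (fun A : 'M[R]_(m, n) => A i j).
  by move=> A; exact: coord_continuous.
by move/continuousP; apply; exact: interval_open.
Qed.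

Lemma measurable_fun_mxP d (T : measurableType d) m n (f : T -> 'M[R]_(m, n)) :
  (forall i j, measurable_fun [set: T] (fun t => f t i j)) ->
  measurable_fun [set: T] f.
Proof.
move=> mf; apply: (measurability (@open 'M[R]_(m, n))) => //.
move=> _ [U oU <-]; rewrite setTI.
pose B (q : 'M[rat]_(m, n) * nat) : set 'M[R]_(m, n) :=
  [set A | forall i j, `|A i j - ratr (q.1 i j)| < q.2.+1%:R^-1].
have -> : f @^-1` U =
    \bigcup_q (if `[< B q `<=` U >] then f @^-1` B q else set0).
  apply/seteqP; split=> [t Uft|t [q _]]; last first.
    by case: asboolP => // + Bt; apply.
  have /nbhs_ballP[e /= e0 eU] : nbhs (f t) U by exact: open_nbhs_nbhs.
  have [k ke] : exists k : nat, k.+1%:R^-1 < e / 2.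
    have [k _ kP] := near_infty_natSinv_lt (PosNum (divr_gt0 e0 (ltr0n R 2))).
    by exists k; apply: (kP k) => /=.
  have k0 : 0 < k.+1%:R^-1 :> R by rewrite invr_gt0.
  have H i j : exists q : rat, `|f t i j - ratr q| < k.+1%:R^-1.
    have [|q] := @rat_in_itvoo R (f t i j - k.+1%:R^-1) (f t i j + k.+1%:R^-1).
      by rewrite ltrD2l gtrN.
    by rewrite in_itv/= => qP; exists q; rewrite distrC ltr_distl.
  pose Q := \matrix_(i, j) sval (cid (H i j)).
  exists (Q, k) => //; case: asboolP => [_|]; last first.
    apply: contra_notP => _ A /= BA; apply: eU; split => // i j.
    rewrite /ball/=.
    have := BA i j; rewrite /Q mxE; case: cid => q/= fq Aq.
    rewrite -(subrKA (ratr q)) (le_lt_trans (ler_normD _ _))//.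
    by rewrite [e]splitr ltrD// ?(lt_trans _ ke)// distrC.
  by move=> i j /=; rewrite mxE; case: cid.
apply: countable_bigcupT_measurable => [|q]; first exact: countableP.
case: asboolP => // _.
rewrite (_ : _ @^-1` _ = \bigcap_(i in [set: 'I_m]) \bigcap_(j in [set: 'I_n])
   (fun t => f t i j) @^-1` [set x | `|x - ratr (q.1 i j)| < q.2.+1%:R^-1]).
  apply: fin_bigcap_measurable; first exact: finite_finset.
  move=> i _; apply: fin_bigcap_measurable; first exact: finite_finset.
  move=> j _; rewrite -[X in measurable X]setTI; apply: mf => //.
  rewrite (_ : [set x | _] = ball (ratr (q.1 i j) : R) q.2.+1%:R^-1).
    exact: measurable_ball.
  by apply/seteqP; split=> x; rewrite /ball/= distrC.
by apply/seteqP; split=> [t Bt i _ j _|t Bt i j]; [exact: Bt|exact: Bt].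
Qed.

Definition cons_rV n (z : R * 'rV[R]_n) : 'rV[R]_n.+1 :=
  \row_(i < n.+1) oapp (fun j => z.2 ord0 j) z.1 (unlift ord0 i).

Definition uncons_rV n (v : 'rV[R]_n.+1) : R * 'rV[R]_n :=
  (v ord0 ord0, \row_(j < n) v ord0 (lift ord0 j)).

Lemma cons_rVK n : cancel (@cons_rV n) (@uncons_rV n).
Proof.
move=> [x v]; congr pair; first by rewrite mxE unlift_none.
by apply/rowP => j; rewrite !mxE liftK.
Qed.

Lemma measurable_cons_rV n : measurable_fun [set: R * 'rV[R]_n] (@cons_rV n).
Proof.
apply: measurable_fun_mxP => i j.
under eq_fun do rewrite mxE.
case: unliftP => [k _|_] /=; last exact: measurable_fst.
exact: (measurableT_comp (measurable_mx_entry _ _)).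
Qed.

Lemma measurable_uncons_rV n : measurable_fun [set: 'rV[R]_n.+1] (@uncons_rV n).
Proof.
apply/measurable_fun_pair; first exact: measurable_mx_entry.
apply: measurable_fun_mxP => i j.
under eq_fun do rewrite mxE.
exact: measurable_mx_entry.
Qed.

Section lebesgue_step.
Variables (n : nat)
  (mu : {sigma_finite_measure set 'rV[R]_n -> \bar R}).

Definition lebesgue_step : set 'rV[R]_n.+1 -> \bar R :=
  pushforward (lebesgue_measure \x mu)%E (@cons_rV n).

HB.instance Definition _ := Measure.copy lebesgue_step
  (measure_function_pushforward__canonical__measure_function_Measure
    (lebesgue_measure \x mu)%E (@measurable_cons_rV n)).

Let lebesgue_step_sigma_finite : sigma_finite setT lebesgue_step.
Proof.
have /sigma_finiteP[F [FT ndF mF]] := sigma_finiteT (@lebesgue_measure R).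
have /sigma_finiteP[G [GT ndG mG]] := sigma_finiteT mu.
exists (fun k => @uncons_rV n @^-1` (F k `*` G k)).
  rewrite -preimage_bigcup (_ : \bigcup_k _ = setT) ?preimage_setT//.
  apply/seteqP; split=> // -[x v] _.
  have [k _ Fk] : (\bigcup_k F k) x by rewrite -FT.
  have [l _ Gl] : (\bigcup_l G l) v by rewrite -GT.
  exists (maxn k l) => //; split => /=.
    by move: x Fk; exact/subsetPset/ndF/leq_maxl.
  by move: v Gl; exact/subsetPset/ndG/leq_maxr.
move=> k; have [mFk Fk] := mF k; have [mGk Gk] := mG k; split.
  rewrite -[X in measurable X]setTI; apply: measurable_uncons_rV => //.
  exact: measurableX.
rewrite /lebesgue_step /pushforward -comp_preimage.
rewrite (_ : _ \o _ = id); last by apply/funext => z; exact: cons_rVK.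
by rewrite product_measure1E// lte_mul_pinfty// ge0_fin_numE.
Qed.

HB.instance Definition _ := Measure_isSigmaFinite.Build _ _ _ lebesgue_step
  lebesgue_step_sigma_finite.

End lebesgue_step.

(* d-dimensional Lebesgue measure, as the iterated product of one-dimensional
   Lebesgue measures. *)
Fixpoint lebesgue_rV (n : nat) : {sigma_finite_measure set 'rV[R]_n -> \bar R} :=
  match n with
  | 0 => [the {sigma_finite_measure set 'rV[R]_0 -> \bar R} of
            \d_ (0 : 'rV[R]_0)]
  | k.+1 => [the {sigma_finite_measure set 'rV[R]_k.+1 -> \bar R} of
               lebesgue_step (lebesgue_rV k)]
  end.

End borel_matrix.

Notation regime_space R d m := ('rV[R]_d * 'I_m.+1)%type.

Section measure_notions.
Local Open Scope ereal_scope.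

Definition msupport (T : topologicalType) (R : realType)
    (mu : set T -> \bar R) : set T :=
  [set x | forall U : set T, open U -> U x -> 0 < mu U].

Definition is_density d (T : measurableType d) (R : realType)
    (al be : set T -> \bar R) (phi : T -> \bar R) : Prop :=
  [/\ measurable_fun [set: T] phi, (forall x, 0 <= phi x) &
      forall A, measurable A -> al A = \int[be]_(x in A) phi x].

(* [xget] picks a version of the Radon-Nikodym derivative; the default value is
   irrelevant when [al] is finite and [be] is sigma-finite. *)
Definition rel_entropy d (T : measurableType d) (R : realType)
    (al be : set T -> \bar R) : \bar R :=
  if `[< al `<< be >]
  then \int[al]_x lne (xget (cst +oo) (is_density al be) x)
  else +oo.

Definition is_coupling d1 d2 (T1 : measurableType d1) (T2 : measurableType d2)
    (R : realType) (al : set T1 -> \bar R) (be : set T2 -> \bar R)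
    (gam : set (T1 * T2) -> \bar R) : Prop :=
  (forall A, measurable A -> gam (A `*` [set: T2]) = al A) /\
  (forall B, measurable B -> gam ([set: T1] `*` B) = be B).

(* [k] is a version of the conditional probability P(A | e). *)
Definition is_cond_prob d1 d2 (T1 : measurableType d1) (T2 : measurableType d2)
    (R : realType) (P : set T1 -> \bar R) (e : T1 -> T2) (A : set T1)
    (k : T2 -> \bar R) : Prop :=
  [/\ measurable_fun [set: T2] k, (forall z, 0 <= k z) &
      forall C, measurable C ->
        P (A `&` e @^-1` C) = \int[pushforward P e]_(z in C) k z].

End measure_notions.

Section euclidean.
Context (R : realType) (d : nat).

(* The norm of the normed module 'rV[R]_d is the maximum norm. *)
Definition sqdist (x y : 'rV[R]_d) : R :=
  \sum_(k < d) (x ord0 k - y ord0 k) ^+ 2.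

Definition W2 (eta mu : set 'rV[R]_d -> \bar R) : \bar R :=
  poweR (ereal_inf [set (\int[pi]_z (sqdist z.1 z.2)%:E)%E |
    pi in [set pi : probability ('rV[R]_d * 'rV[R]_d)%type R |
           is_coupling eta mu pi]]) 2^-1.

End euclidean.

Section smoothness.
Context (R : realType) (V : normedModType R).

Definition C1_on (U : set V) (F : V -> R) : Prop :=
  forall v x, U x ->
    derivable F x v /\ {for x, continuous (fun y => 'D_v F y)}.

(* For open [U] in finite dimension. *)
Definition C2_on (U : set V) (F : V -> R) : Prop :=
  [/\ (forall x, U x -> {for x, continuous F}), C1_on U F &
      forall v, C1_on U (fun x => 'D_v F x)].

(* On a set that is not open, being of class C^2 means being the restriction of
   a C^2 function defined on an open neighbourhood. *)
Definition of_class_C2_on (K : set V) (F : V -> R) : Prop :=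
  exists (U : set V) (G : V -> R),
    [/\ open U, K `<=` U, C2_on U G & {in K, F =1 G}].

End smoothness.

Section path_space.
Context (R : realType) (T : R) (d m : nat).

Definition cadlag (i : R -> 'I_m.+1) : Prop :=
  (forall t, 0 <= t < T -> i s @[s --> t^'+] --> i t) /\
  (forall t, 0 < t <= T -> cvg (i s @[s --> t^'-])).

(* C([0,T]; R^d) x D([0,T]; I). Paths are total functions on R, frozen outside
   [0,T] so that each pair of paths on [0,T] has exactly one representative. *)
Record path_space := PathSpace {
  path_X : R -> 'rV[R]_d ;
  path_I : R -> 'I_m.+1 ;
  path_X_continuous : {within `[0, T], continuous path_X} ;
  path_I_cadlag : cadlag path_I ;
  path_frozen : forall t, ~~ (0 <= t <= T) -> path_X t = 0 /\ path_I t = ord0 }.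

Let zero_cadlag : cadlag (cst ord0).
Proof. by split=> t _; [exact: cvg_cst|apply: is_cvg_cst]. Qed.

Let zero_continuous : {within `[0, T], continuous (cst (0 : 'rV[R]_d))}.
Proof. by apply: continuous_subspaceT => x; exact: cvg_cst. Qed.

Definition zero_path : path_space :=
  @PathSpace (cst 0) (cst ord0) zero_continuous zero_cadlag
    (fun _ _ => conj erefl erefl).

HB.instance Definition _ := gen_eqMixin path_space.
HB.instance Definition _ := gen_choiceMixin path_space.
HB.instance Definition _ := isPointed.Build path_space zero_path.

Definition path_Z (t : R) (w : path_space) : regime_space R d m :=
  (path_X w t, path_I w t).

Definition cylinders (D : set R) : set (set path_space) :=
  [set C | exists2 t, D t & exists2 B, measurable B & C = path_Z t @^-1` B].

HB.instance Definition _ := Measurable.copy path_space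
  (g_sigma_algebraType (cylinders `[0, T])).

Definition endpoints (w : path_space) : regime_space R d m * 'rV[R]_d :=
  (path_Z 0 w, path_X w T).

End path_space.

Section ito.
Context (R : realType) (T : R) (d : nat) (dO : measure_display)
  (O : measurableType dO) (Pr : probability O R).

Definition filtration (F : R -> set (set O)) : Prop :=
  (forall t, 0 <= t <= T ->
     sigma_algebra [set: O] (F t) /\ F t `<=` measurable) /\
  (forall s t, 0 <= s -> s <= t -> t <= T -> F s `<=` F t).

Definition measurable_wrt d' (U : measurableType d') (G : set (set O))
    (f : O -> U) : Prop :=
  forall B, measurable B -> G (f @^-1` B).

(* Given F_s, the increment W_t - W_s has independent centred Gaussian
   coordinates of variance t - s ([normal_prob] takes a standard deviation). *)
Definition brownian_motion (F : R -> set (set O))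
    (W : R -> O -> 'rV[R]_d) : Prop :=
  [/\ (forall t, 0 <= t <= T -> measurable_wrt (F t) (W t)),
      (\forall w \ae Pr, W 0 w = 0),
      (forall w, {within `[0, T], continuous (fun t => W t w)}) &
      forall s t (A : set O) (B : 'I_d -> set R),
        0 <= s -> s < t -> t <= T -> F s A -> (forall k, measurable (B k)) ->
        Pr (A `&` [set w | forall k, B k (W t w ord0 k - W s w ord0 k)]) =
        (Pr A * \prod_(k < d) normal_prob 0 (Num.sqrt (t - s)) (B k))%E].

Record simple_integrand := SimpleIntegrand {
  si_size : nat ;
  si_knot : nat -> R ;
  si_coef : nat -> O -> 'M[R]_d }.

Definition is_simple (F : R -> set (set O)) (H : simple_integrand) : Prop :=
  [/\ si_knot H 0 = 0, si_knot H (si_size H) = T,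
      (forall k, (k < si_size H)%N -> si_knot H k <= si_knot H k.+1),
      (forall k, (k < si_size H)%N ->
         measurable_wrt (F (si_knot H k)) (si_coef H k)) &
      exists M : R, forall k w, (k < si_size H)%N -> `|si_coef H k w| <= M].

Definition si_val (H : simple_integrand) (t : R) (w : O) : 'M[R]_d :=
  \sum_(k < si_size H)
    \1_(`]si_knot H k, si_knot H k.+1] : set R) t *: si_coef H k w.

(* Vectors are rows, hence the transpose. *)
Definition si_integral (W : R -> O -> 'rV[R]_d) (H : simple_integrand)
    (t : R) (w : O) : 'rV[R]_d :=
  \sum_(k < si_size H)
    (W (Num.min t (si_knot H k.+1)) w - W (Num.min t (si_knot H k)) w)
      *m (si_coef H k w)^T.

(* Y_t = \int_0^t h_s dW_s, as a limit in probability of integrals of simple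
   integrands. *)
Definition ito_integral (F : R -> set (set O)) (W : R -> O -> 'rV[R]_d)
    (h : R -> O -> 'M[R]_d) (Y : R -> O -> 'rV[R]_d) : Prop :=
  exists H : nat -> simple_integrand,
    [/\ (forall n, is_simple F (H n)),
        (forall e : R, 0 < e ->
           Pr [set w | (e%:E <= \int[lebesgue_measure]_(s in `[0%R, T])
             (\sum_(k < d) \sum_(l < d)
                (si_val (H n) s w k l - h s w k l) ^+ 2)%R%:E)%E]
             @[n --> \oo] --> 0%E) &
        forall t, 0 <= t <= T -> forall e : R, 0 < e ->
          Pr [set w | e <= `|si_integral W (H n) t w - Y t w|]
            @[n --> \oo] --> 0%E].

End ito.

Section reference_process.
Context (R : realType) (T : R) (d m : nat).
Local Notation Path := (path_space T d m).
Variables (b : 'I_m.+1 -> R -> 'rV[R]_d -> 'rV[R]_d)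
  (sigma : 'I_m.+1 -> R -> 'rV[R]_d -> 'M[R]_d)
  (lambda : 'I_m.+1 -> 'I_m.+1 -> R -> 'rV[R]_d -> R).

Definition admissible_coefficients : Prop :=
  let D := (`[0, T] : set R) `*` [set: 'rV[R]_d] in
  [/\ (forall i, measurable_fun D (fun z => b i z.1 z.2)),
      (forall i, measurable_fun D (fun z => sigma i z.1 z.2)),
      (forall i j, measurable_fun D (fun z => lambda i j z.1 z.2)) &
      forall i j t x, 0 <= t <= T -> 0 <= lambda i j t x].

(* dX_t = b_{I_t}(t, X_t) dt + sigma_{I_t}(t, X_t) dW_t on [0,T], where
   X_t = path_X (Z w) t and I_t = path_I (Z w) t. *)
Definition solves_sde (dO : measure_display) (O : measurableType dO)
    (Pr : probability O R) (F : R -> set (set O)) (W : R -> O -> 'rV[R]_d)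
    (Z : O -> Path) : Prop :=
  let drift s w := b (path_I (Z w) s) s (path_X (Z w) s) in
  let diffusion s w := sigma (path_I (Z w) s) s (path_X (Z w) s) in
  exists Y : R -> O -> 'rV[R]_d,
    [/\ ito_integral T Pr F W diffusion Y,
        (\forall w \ae Pr, forall k, (@lebesgue_measure R).-integrable `[0, T]
           (fun s => (drift s w ord0 k)%:E)) &
        forall t, 0 <= t <= T -> \forall w \ae Pr, forall k,
          path_X (Z w) t ord0 k = path_X (Z w) 0 ord0 k
            + fine (\int[lebesgue_measure]_(s in `[0%R, t])
                      (drift s w ord0 k)%:E)%E
            + Y t w ord0 k].

Definition is_sde_law (P : probability Path R) : Prop :=
  exists (dO : measure_display) (O : measurableType dO) (Pr : probability O R)
    (F : R -> set (set O)) (W : R -> O -> 'rV[R]_d) (Z : O -> Path),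
    [/\ filtration T F, brownian_motion T Pr F W,
        measurable_fun [set: O] Z /\
        (forall t, 0 <= t <= T -> measurable_wrt (F t) (fun w => path_Z t (Z w))),
        solves_sde Pr F W Z &
        forall A, measurable A -> P A = Pr (Z @^-1` A)].

Definition is_markov (P : probability Path R) : Prop :=
  forall s t, 0 <= s -> s <= t -> t <= T ->
  forall B : set (regime_space R d m), measurable B ->
  exists p : regime_space R d m -> \bar R,
    [/\ measurable_fun [set: regime_space R d m] p,
        (forall z, 0 <= p z)%E &
        forall G, <<s @cylinders R T d m `[0, s] >> G ->
          P (G `&` path_Z t @^-1` B) = (\int[P]_(w in G) p (path_Z s w))%E].

(* P(I_{t+h} = j | I_t = i, X_t = x) = lambda_ij(t,x) h + o(h) as h decreases
   to 0; [q t h i j] is a version of the left-hand side as a function of x. *)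
Definition has_jump_rates (P : probability Path R) : Prop :=
  exists q : R -> R -> 'I_m.+1 -> 'I_m.+1 -> 'rV[R]_d -> R,
    (forall t h i j, 0 <= t -> 0 < h -> t + h <= T -> i != j ->
       [/\ measurable_fun [set: 'rV[R]_d] (q t h i j),
           (forall x, 0 <= q t h i j x) &
           forall A, measurable A ->
             P [set w | [/\ A (path_X w t), path_I w t = i &
                            path_I w (t + h) = j]] =
             (\int[P]_(w in [set w | A (path_X w t) /\ path_I w t = i])
                (q t h i j (path_X w t))%:E)%E]) /\
    (forall t i j x, 0 <= t < T -> i != j ->
       ((q t h i j x - lambda i j t x * h) / h) @[h --> 0^'+] --> (0 : R)).

Definition initial_part (P : set Path -> \bar R) (i : 'I_m.+1)
    (A : set 'rV[R]_d) : \bar R :=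
  P [set w | A (path_X w 0) /\ path_I w 0 = i].

Definition is_reference_law (P : probability Path R) : Prop :=
  [/\ admissible_coefficients, is_sde_law P, is_markov P, has_jump_rates P &
      forall i, exists p, is_density (initial_part P i) (@lebesgue_rV R d) p].

(* [r i j x y] is r_ij(0,x;T,y), characterised by
   P(X_T \in dy, I_T = j | X_0 = x, I_0 = i) = r_ij(0,x;T,y) dy. *)
Definition is_transition_density (P : probability Path R)
    (r : 'I_m.+1 -> 'I_m.+1 -> 'rV[R]_d -> 'rV[R]_d -> R) : Prop :=
  forall i j,
    [/\ measurable_fun [set: 'rV[R]_d * 'rV[R]_d] (fun z => r i j z.1 z.2),
        (forall x y, 0 <= r i j x y) &
        forall A B, measurable A -> measurable B ->
          P [set w | [/\ A (path_X w 0), path_I w 0 = i,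
                         B (path_X w T) & path_I w T = j]] =
          (\int[initial_part P i]_(x in A)
             \int[@lebesgue_rV R d]_(y in B) (r i j x y)%:E)%E].

End reference_process.

Section projected_problem.
Context (R : realType) (d m : nat).
Local Open Scope ereal_scope.
Local Notation E := (regime_space R d m).

Definition regime_part (eta : set E -> \bar R) (i : 'I_m.+1)
    (A : set 'rV[R]_d) : \bar R := eta (A `*` [set i]).

Definition regime_mass (eta : set E -> \bar R) (i : 'I_m.+1) : \bar R :=
  regime_part eta i [set: 'rV[R]_d].

Definition regime_cond (eta : set E -> \bar R) (i : 'I_m.+1)
    (A : set 'rV[R]_d) : \bar R := regime_part eta i A * (regime_mass eta i)^-1.

Definition projected_density
    (r : 'I_m.+1 -> 'I_m.+1 -> 'rV[R]_d -> 'rV[R]_d -> R)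
    (i : 'I_m.+1) (x y : 'rV[R]_d) : R := (\sum_(j < m.+1) r i j x y)%R.

Variables (rbar : 'I_m.+1 -> 'rV[R]_d -> 'rV[R]_d -> R)
  (rho : set E -> \bar R) (mu : set 'rV[R]_d -> \bar R).

Definition projected_cost (z : E * 'rV[R]_d) : \bar R :=
  - lne (rbar z.1.2 z.1.1 z.2)%:E.

Definition static_objective (gam : set (E * 'rV[R]_d) -> \bar R) : \bar R :=
  rel_entropy gam (rho \x mu) + \int[gam]_z projected_cost z.

(* Equality of measures is equality on measurable sets. *)
Definition is_optimal_coupling (gam : probability (E * 'rV[R]_d)%type R) :
    Prop :=
  is_coupling rho mu gam /\
  forall gam' : probability (E * 'rV[R]_d)%type R, is_coupling rho mu gam' ->
    static_objective gam <= static_objective gam' /\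
    (static_objective gam' = static_objective gam ->
     forall C, measurable C -> gam' C = gam C).

Definition sinkhorn_f (g : 'rV[R]_d -> \bar R) (i : 'I_m.+1) (x : 'rV[R]_d) :
    \bar R :=
  (\int[mu]_y ((rbar i x y)%:E * g y))^-1.

Definition sinkhorn_g (f : 'I_m.+1 -> 'rV[R]_d -> \bar R) (y : 'rV[R]_d) :
    \bar R :=
  (\sum_(i < m.+1) \int[regime_part rho i]_x ((rbar i x y)%:E * f i x))^-1.

Fixpoint iterate_g (g0 : 'rV[R]_d -> R) (n : nat) : 'rV[R]_d -> \bar R :=
  match n with
  | 0 => fun y => (g0 y)%:E
  | n'.+1 => sinkhorn_g (sinkhorn_f (iterate_g g0 n'))
  end.

(* The index is shifted: [iterate_fS g0 n] is f^{n+1}. *)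
Definition iterate_fS (g0 : 'rV[R]_d -> R) (n : nat) :
    'I_m.+1 -> 'rV[R]_d -> \bar R :=
  sinkhorn_f (iterate_g g0 n).

(* The measure f_i(x) rbar_i(0,x;T,y) g(y) rho_i(dx) mu(dy), written as a density
   with respect to the product of rho and mu. *)
Definition coupling_of (f : 'I_m.+1 -> 'rV[R]_d -> \bar R)
    (g : 'rV[R]_d -> \bar R) (C : set (E * 'rV[R]_d)) : \bar R :=
  \int[rho \x mu]_(z in C)
    (f z.1.2 z.1.1 * (rbar z.1.2 z.1.1 z.2)%:E * g z.2).

(* gamma^{n+1,n} and gamma^{n+1,n+1}: the indices are shifted as well. *)
Definition half_coupling (g0 : 'rV[R]_d -> R) (n : nat) :=
  coupling_of (iterate_fS g0 n) (iterate_g g0 n).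

Definition full_coupling (g0 : 'rV[R]_d -> R) (n : nat) :=
  coupling_of (iterate_fS g0 n) (iterate_g g0 n.+1).

End projected_problem.

(* Q o (Z_0,X_T)^{-1} = gam and Q(A | Z_0,X_T) = P(A | Z_0,X_T) for every
   event A. *)
Definition is_lift (R : realType) (T : R) (d m : nat)
    (P : set (path_space T d m) -> \bar R)
    (gam : set (regime_space R d m * 'rV[R]_d) -> \bar R)
    (Q : set (path_space T d m) -> \bar R) : Prop :=
  (forall C, measurable C -> pushforward Q (@endpoints R T d m) C = gam C) /\
  (forall A, measurable A -> exists k,
     is_cond_prob P (@endpoints R T d m) A k /\
     is_cond_prob Q (@endpoints R T d m) A k).

(* Main.v *)
Require Import Defs.
From HB Require Import structures.
From mathcomp Require Import all_boot all_order all_algebra.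
From mathcomp Require Import all_classical all_reals all_analysis measurable_realfun.
From mathcomp Require Import ring lra.
Set Implicit Arguments. Unset Strict Implicit. Unset Printing Implicit Defensive.
Import Order.TTheory GRing.Theory Num.Theory numFieldNormedType.Exports.
Local Open Scope classical_set_scope. Local Open Scope ring_scope.

(** The law [rho] and the measure [mu] have compact supports and the projected
    transition density [rbar] is continuous and positive there, so between the
    supports it takes its values in an interval [[a, b]] with [0 < a < b]. The
    finite entropy with respect to gamma^{1,0} forces [g0] to be integrable
    ([half_coupling0_finite]). The rates follow from these two facts.

    Contraction. Put S g (x) = 1 / (integral of k(x, y) g(y)), the map whose
    alternate application in the two variables is the Sinkhorn iteration. If p
    g <= g' <= q g, then the kernel is at least [a] on the two nonnegative
    functions g' - p g and q g - g'; this moves both ends of the interval [[p,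
    q]] inwards, by amounts that shrink its length by the factor 1 - a / b,
    and the resulting inequality is again of the form p' S g' <= S g <= q' S
    g' ([schrodinger_map_contraction]). Applied to two successive iterates, it
    shows that u_n = g^n / g^{n+1} takes its values in intervals [[p_n, q_n]]
    whose lengths decay geometrically ([sinkhorn_G_ratio]).

    Entropy. The half-step coupling gamma^{n+1,n} has first marginal [rho] and
    second marginal u_n [mu]; in particular u_n has mean 1 and p_n <= 1 <=
    q_n. The limit of the iteration is never constructed: the optimal coupling
    is compared with the competitor

      gamma' = gamma^{n+1,n} / q_n + rho x (1 - u_n / q_n) mu,

    which has the right marginals and whose density with respect to
    gamma^{n+1,n} is at most 1 + C (q_n - p_n), because the density of
    gamma^{n+1,n} with respect to rho x mu is at least (a / b)^2
    ([sinkhorn_competitor]). On couplings of [rho] and [mu], the static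
    objective and H(. | gamma^{n+1,n}) differ by a constant, since
    gamma^{n+1,n} has density f(x) k(x, y) g(y) ([entropic_cost_coupling]). So
    the optimal coupling has the smaller relative entropy of the two, which is
    at most log(1 + C (q_n - p_n)). The same competitor serves for
    gamma^{n+1,n+1}, whose density is that of gamma^{n+1,n} divided by u_n
    ([sinkhorn_rate]). As [g0] need not be bounded away from 0, this works for
    n >= 1, and the entropies for n = 0, finite by hypothesis, are absorbed in
    the constant.

    Paths. Conditional probabilities given the endpoints are unique up to null
    sets of the endpoint law of [P], which dominates rho x mu because H(rho x
    mu | P_{0,T}) is finite. Hence lifting two couplings multiplies both by
    the same kernel, the density of one lift with respect to the other is the
    density of the couplings evaluated at the endpoints, and relative entropy
    is preserved ([rel_entropy_lift]). *)

(** * Measurability and densities *)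

Section measurability.
Context {R : realType}.

Lemma measurable_lne : measurable_fun [set: \bar R] (@lne R).
Proof.
have -> : @lne R = fun x => if (x <= 0)%E then -oo%E
    else if x == +oo%E then +oo%E else (ln (fine x))%:E.
  by apply/funext => -[r| |]; rewrite ?lee_fin ?leey ?leNye ?leye_eq.
apply: measurable_fun_ifT => //; first exact: measurable_fun_lee.
apply: measurable_fun_ifT => //; first exact: measurable_fun_eqe.
by apply/measurable_EFinP/measurableT_comp => //; exact: fine_measurable.
Qed.

Lemma measurable_invr : measurable_fun [set: R] (@GRing.inv R).
Proof.
(* A formula without case distinction, valid at 0 as well. *)
have -> : @GRing.inv R = fun x => x * expR (- ln (x ^+ 2)).
  apply/funext => x; have [->|x0] := eqVneq x 0; first by rewrite invr0 mul0r.
  by rewrite expRN lnK ?posrE ?exprn_even_gt0// expr2 invfM mulrA divff ?mul1r.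
apply: measurable_funM => //; apply: measurableT_comp => //.
apply: measurableT_comp => //; apply: measurableT_comp => //.
Qed.

Lemma measurable_inve : measurable_fun [set: \bar R] (@inve R).
Proof.
have -> : @inve R = fun x => if x == 0%E then +oo%E
    else if x == -oo%E then -oo%E
    else if x == +oo%E then 0%E else ((fine x)^-1)%:E.
  by apply/funext => -[r| |]; rewrite ?inver ?eqe ?invey ?inveNy.
apply: measurable_fun_ifT => //; first exact: measurable_fun_eqe.
apply: measurable_fun_ifT => //; first exact: measurable_fun_eqe.
apply: measurable_fun_ifT => //; first exact: measurable_fun_eqe.
apply/measurable_EFinP; apply: measurableT_comp; first exact: measurable_invr.
exact: fine_measurable.
Qed.

End measurability.

Section densities.
Context d (T : measurableType d) (R : realType).
Local Open Scope ereal_scope.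
Implicit Types (al be mu : {measure set T -> \bar R}).

Lemma probability_lty (P : probability T R) : P setT < +oo.
Proof. by rewrite probability_setT ltry. Qed.

Lemma is_density_finite (al be : set T -> \bar R) (f : T -> \bar R) :
  is_density al be f -> al setT < +oo -> \int[be]_x f x < +oo.
Proof. by case=> _ _ fE; rewrite -fE. Qed.

Lemma is_density_integrable (al : set T -> \bar R) be (f : T -> \bar R) :
  is_density al be f -> al setT < +oo -> be.-integrable setT f.
Proof.
move=> af aoo; have [mf f0 _] := af; apply/integrableP; split => //.
under eq_integral do rewrite gee0_abs//.
exact: is_density_finite af aoo.
Qed.

Lemma is_density_unique (al : set T -> \bar R) be (f g : T -> \bar R) :
  al setT < +oo -> is_density al be f -> is_density al be g ->
  ae_eq be setT f g.
Proof.
move=> aoo af ag; have [mf f0 fE] := af; have [mg g0 gE] := ag.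
apply: integral_ae_eq => //; first exact: is_density_integrable af aoo.
by move=> E _ mE; rewrite -fE// -gE.
Qed.

Lemma is_density_dominates (al : set T -> \bar R) be (f : T -> \bar R) :
  is_density al be f -> al `<< be.
Proof.
move=> [mf f0 fE]; apply/null_content_dominatesP => A mA beA0.
by rewrite fE// null_set_integral//; exact: measurable_funTS.
Qed.

Import HBNNSimple.

(** The Sinkhorn couplings and the regime parts are bare set functions; this
    lemma trades them for genuine measures that agree with them on measurable
    sets. *)
Lemma eq_integral_measure (al be : set T -> \bar R) (f : T -> \bar R) D :
  (forall A, measurable A -> al A = be A) ->
  \int[al]_(x in D) f x = \int[be]_(x in D) f x.
Proof.
move=> ab; rewrite /integral.
have sE (h : {nnsfun T >-> R}) : sintegral al h = sintegral be h.
  by apply: eq_fsbigr => r _; rewrite ab.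
by congr (ereal_sup _ - ereal_sup _); apply/seteqP; split=> _ [h hP <-];
  exists h.
Qed.

Lemma eq_is_density (al al' : set T -> \bar R) (be be' : set T -> \bar R) f :
  (forall A, measurable A -> al A = al' A) ->
  (forall A, measurable A -> be A = be' A) ->
  is_density al be f -> is_density al' be' f.
Proof.
move=> aE bE [mf f0 fE]; split => // A mA; rewrite -aE// fE//.
exact: eq_integral_measure.
Qed.

Lemma eq_rel_entropy (al al' be be' : set T -> \bar R) :
  (forall A, measurable A -> al A = al' A) ->
  (forall A, measurable A -> be A = be' A) ->
  rel_entropy al be = rel_entropy al' be'.
Proof.
move=> aE bE; rewrite /rel_entropy.
have -> : is_density al be = is_density al' be'.
  apply/funext => f; apply/propext; split; apply: eq_is_density => // A mA.
    by rewrite aE.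
  by rewrite bE.
have -> : (al `<< be) = (al' `<< be').
  apply/propext; split=> ab A nA B mB BA.
    by rewrite -aE//; apply: (ab A) => // C mC CA; rewrite bE//; exact: nA.
  by rewrite aE//; apply: (ab A) => // C mC CA; rewrite -bE//; exact: nA.
case: asboolP => // _; exact: eq_integral_measure.
Qed.

(** Both sides are limits of integrals of the same simple functions; the
    values 0 and +oo of [f] and [h] make the continuity of the product
    delicate, hence the case analysis on the right-hand side. *)
Lemma integral_density al be (f : T -> \bar R) (h : T -> \bar R) D :
  is_density al be f -> measurable D -> measurable_fun D h ->
  (forall x, D x -> 0 <= h x) ->
  \int[al]_(x in D) h x = \int[be]_(x in D) (h x * f x).
Proof.
move=> [mf f0 fE] mD mh h0.
pose hn := nnsfun_approx mD mh.
have mhf n : measurable_fun D (fun x => (hn n x)%:E * f x).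
  apply: emeasurable_funM; apply: measurable_funTS => //.
  exact/measurable_EFinP.
have hn_cvg x : D x -> (hn n x)%:E @[n --> \oo] --> h x.
  by move=> Dx; apply: cvg_nnsfun_approx.
have hn_nd x : {homo (fun n => (hn n x)%:E) : m n / (m <= n)%N >-> m <= n}.
  by move=> m n mn; rewrite lee_fin; exact/lefP/nd_nnsfun_approx.
have -> : \int[al]_(x in D) h x = limn (fun n => \int[al]_(x in D) (hn n x)%:E).
  rewrite -monotone_convergence//.
  - by apply: eq_integral => x /[!inE] Dx; apply/esym/cvg_lim => //; exact: hn_cvg.
  - by move=> n; exact/measurable_EFinP/measurable_funTS.
  - by move=> n x _; rewrite lee_fin.
have -> : \int[be]_(x in D) (h x * f x) =
    limn (fun n => \int[be]_(x in D) ((hn n x)%:E * f x)).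
  rewrite -monotone_convergence//.
  - apply: eq_integral => x /[!inE] Dx.
    have := ereal_nondecreasing_cvgn (hn_nd x) => hs.
    (* Needed when f x = +oo: then h x > 0 forces hn n x > 0 for large n. *)
have hE : h x = ereal_sup (range (fun n => (hn n x)%:E)).
      by apply: cvg_unique hs; [exact: ereal_hausdorff|exact: hn_cvg].
    apply/esym/cvg_lim => //.
    have [fx|fx] := boolP (f x \is a fin_num).
      by apply: cvgeZr => //; exact: hn_cvg.
    have -> : f x = +oo.
      by move: fx (f0 x); case: (f x) => //.
    have [hx0|hx0] := eqVneq (h x) 0.
      rewrite hx0 mul0e; apply: cvg_near_cst; apply: nearW => n.
      have : (hn n x)%:E <= 0.
        by rewrite -hx0 hE; apply: ereal_sup_ubound; exists n.
      rewrite lee_fin => hn0.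
      have /eqP -> : hn n x == 0%R by rewrite eq_le hn0/= fun_ge0.
      by rewrite mul0e.
    rewrite gt0_muley; last by rewrite lt0e hx0 h0.
    have : 0 < h x by rewrite lt0e hx0 h0.
    rewrite {1}hE => /ereal_sup_gt[_ [n _ <-] hn0].
    apply: cvg_near_cst; exists n => // k /= nk.
    by rewrite gt0_muley// (lt_le_trans hn0)// hn_nd.
  - by move=> n x _; rewrite mule_ge0// lee_fin.
  - by move=> x _ m n mn; rewrite lee_wpmul2r//; exact: hn_nd.
apply/congr_lim/funext => n.
have rng := fimfunP (hn n).
have m1 r : measurable (hn n @^-1` [set r]) by exact: measurable_sfunP.
transitivity (\int[al]_(x in D)
   (\sum_(y \in range (hn n)) (y * \1_(hn n @^-1` [set y]) x)%:E)).
  by apply: eq_integral => t tE; rewrite fimfunE -fsumEFin.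
rewrite ge0_integral_fsum//; last 2 first.
- by move=> r; apply: (measurable_comp measurableT) => //; exact: measurable_funM.
- by move=> m y _; exact: nnfun_muleindic_ge0.
transitivity (\int[be]_(x in D) (\sum_(y \in range (hn n))
    (y * \1_(hn n @^-1` [set y]) x)%:E * f x)); last first.
  apply: eq_integral => x xD.
  rewrite -ge0_mule_fsuml => [|y]; last exact: nnfun_muleindic_ge0.
  by rewrite fsumEFin // -(fimfunE _ x).
rewrite ge0_integral_fsum//; last 2 first.
- move=> y; apply: emeasurable_funM; apply: measurable_funTS => //.
  by apply: (measurable_comp measurableT) => //; exact: measurable_funM.
- by move=> m y _; rewrite mule_ge0// nnfun_muleindic_ge0.
apply: eq_fsbigr => r rhn.
have r0 : (0 <= r)%R by move: rhn; rewrite inE => -[t _ <-]; exact: fun_ge0.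
rewrite integralZl_indic_nnsfun// integral_indic//.
under [RHS]eq_integral do rewrite EFinM -muleA.
rewrite ge0_integralZl//; last 2 first.
- apply: emeasurable_funM; first exact/measurable_EFinP.
  exact: measurable_funTS.
- by move=> t _; rewrite mule_ge0// lee_fin.
congr (_ * _); rewrite setIC.
under eq_integral do rewrite muleC.
rewrite (eq_integral (f \_ (hn n @^-1` [set r]))); last first.
  by move=> x xD; rewrite epatch_indic.
by rewrite -integral_mkcondr -fE//; exact: measurableI.
Qed.

End densities.

(** * Relative entropy *)

Section entropy.
Context d (T : measurableType d) (R : realType).
Local Open Scope ereal_scope.
Implicit Types (al be mu : {measure set T -> \bar R}).

(** The choice of a version of the density in [rel_entropy] is immaterial:
    versions agree [be]-almost everywhere, hence [al]-almost everywhere. *)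
Lemma rel_entropy_density al be (f : T -> \bar R) :
  al setT < +oo -> is_density al be f ->
  rel_entropy al be = \int[al]_x lne (f x).
Proof.
move=> aoo af; have ab := is_density_dominates af.
rewrite /rel_entropy; case: asboolP => // _.
have ag : is_density al be (xget (cst +oo) (is_density al be)).
  by apply: xgetPex; exists f.
set g := xget _ _ in ag *.
have [mf _ _] := af; have [mg _ _] := ag.
apply: ae_eq_integral => //.
- exact: measurableT_comp measurable_lne mg.
- exact: measurableT_comp measurable_lne mf.
have := null_dominates_ae_eq measurableT ab (is_density_unique aoo ag af).
by apply: filterS => x /= fg /fg ->.
Qed.

(** The function t |-> t log t is bounded below: this controls the negative
    part of the entropy integral. *)
Lemma lne_funeneg_mul_le1 (f : T -> \bar R) x :
  0 <= f x -> f x \is a fin_num -> (@lne R \o f)^\- x * f x <= 1.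
Proof.
move=> f0 ffin; rewrite funenegE/= -(fineK ffin).
have r0 : (0 <= fine (f x))%R by rewrite fine_ge0.
set r := fine (f x) in r0 *.
have [->|rn0] := eqVneq r 0%R; first by rewrite mule0.
have {rn0}r_gt0 : (0 < r)%R by rewrite lt_def rn0.
rewrite lne_EFin// -EFinN -EFin_max -EFinM lee_fin.
rewrite maxr_pMl ?(ltW r_gt0)// mul0r ge_max ler01 andbT.
rewrite -lnV ?posrE// -ler_pdivlMr// mul1r.
by rewrite (le_trans (ltW (ln_sublinear _)))// invr_gt0.
Qed.

(** The negative part of [lne \o f] has integral at most 1 because [be] is a
    probability, so finiteness of the entropy bounds the positive part. *)
Lemma integrable_lne_density al (be : probability T R) (f : T -> \bar R) :
  al setT < +oo -> is_density al be f -> (forall x, f x \is a fin_num) ->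
  rel_entropy al be < +oo -> al.-integrable setT (@lne R \o f).
Proof.
move=> aoo af ffin; rewrite (rel_entropy_density aoo af) => fin.
have [mf f0 _] := af.
have ml : measurable_fun setT (@lne R \o f).
  exact: measurableT_comp measurable_lne mf.
have neg : \int[al]_x (@lne R \o f)^\- x < +oo.
  rewrite (integral_density af)//; last exact: measurable_funeneg.
  apply: (@le_lt_trans _ _ (\int[be]_x cst 1 x)).
    apply: ge0_le_integral => //.
    - by move=> x _; rewrite mule_ge0.
    - by apply: emeasurable_funM => //; exact: measurable_funeneg.
    - by move=> x _; exact: lne_funeneg_mul_le1.
  by rewrite integral_cst// mul1e [X in X < _](@probability_setT _ _ _ be) ltry.
have pos : \int[al]_x (@lne R \o f)^\+ x < +oo.
  have neg0 : 0 <= \int[al]_x (@lne R \o f)^\- x by exact: integral_ge0.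
  have neg_fin : \int[al]_x (@lne R \o f)^\- x \is a fin_num.
    by rewrite ge0_fin_numE.
  move: fin; rewrite integralE lteBlDr// addye//.
  by move: neg_fin; rewrite fin_numE => /andP[].
apply/integrableP; split => //.
rewrite -/((abse \o (@lne R \o f))) fune_abse ge0_integralD//.
- by rewrite lte_add_pinfty.
- exact: measurable_funepos.
- exact: measurable_funeneg.
Qed.

Lemma rel_entropy_le_ln (al : probability T R) be (f : T -> \bar R) (c : R) :
  is_density al be f -> (1 <= c)%R -> (forall x, f x <= c%:E) ->
  rel_entropy al be <= (ln c)%:E.
Proof.
move=> af c1 fc; rewrite (rel_entropy_density (probability_lty al) af).
have [mf f0 _] := af.
have ml : measurable_fun setT (@lne R \o f).
  exact: measurableT_comp measurable_lne mf.
rewrite integralE (@le_trans _ _ (\int[al]_x (@lne R \o f)^\+ x))//.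
  by rewrite -[leRHS]sube0 leeB// integral_ge0.
have -> : (ln c)%:E = \int[al]_x cst (ln c)%:E x.
  by rewrite integral_cst// [X in _ * X](@probability_setT _ _ _ al) mule1.
apply: ge0_le_integral => //.
- exact: measurable_funepos.
- move=> x _; rewrite funeposE ge_max lee_fin ln_ge0// andbT.
  rewrite /= -lne_EFin ?(lt_le_trans ltr01)// lee_lne// in_itv/= ?f0 ?leey//.
  by rewrite lee_fin (le_trans ler01).
Qed.

Lemma is_density_div al be mu (f : T -> \bar R) (w : T -> R) :
  is_density al mu f -> is_density be mu (EFin \o w) ->
  measurable_fun setT w -> (forall x, (0 < w x)%R) ->
  is_density al be (fun x => f x * (w x)^-1%:E).
Proof.
move=> [mf f0 fE] bw mw w0.
have mfw : measurable_fun setT (fun x => f x * (w x)^-1%:E).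
  apply: emeasurable_funM => //; apply/measurable_EFinP.
  exact: measurableT_comp measurable_invr mw.
have fw0 x : 0 <= f x * (w x)^-1%:E by rewrite mule_ge0// lee_fin invr_ge0 ltW.
split => // A mA; rewrite (integral_density bw)//; last exact: measurable_funTS.
rewrite fE//; apply: eq_integral => x _ /=.
by rewrite -muleA -EFinM mulVf ?mule1// gt_eqF.
Qed.

(** From log(f / w) = log f - log w, where both terms are integrable. *)
Lemma rel_entropy_change al be mu (f : T -> \bar R) (w : T -> R) :
  al setT < +oo -> is_density al mu f -> is_density be mu (EFin \o w) ->
  measurable_fun setT w -> (forall x, (0 < w x)%R) ->
  al.-integrable setT (@lne R \o f) -> al.-integrable setT (EFin \o (@ln R \o w)) ->
  rel_entropy al mu = rel_entropy al be + \int[al]_x (ln (w x))%:E.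
Proof.
move=> aoo af bw mw w0 fi wi; have afw := is_density_div af bw mw w0.
rewrite (rel_entropy_density aoo af) (rel_entropy_density aoo afw).
have E x : lne (f x * (w x)^-1%:E) = lne (f x) - (ln (w x))%:E.
  have [_ f0 _] := af.
  have wV : (0 < (w x)^-1)%R by rewrite invr_gt0.
  have := f0 x; rewrite le_eqVlt => /orP[/eqP <-|fx].
    by rewrite mul0e le0_lneNy.
  rewrite lneM ?in_itv/= ?fx ?leey ?lte_fin ?wV//.
  by rewrite leNgt wV lnV ?posrE.
under [in RHS]eq_integral do rewrite E.
rewrite (integralB _ fi wi)// subeK//.
exact: integrable_fin_num.
Qed.

Lemma density_measure (mu : {measure set T -> \bar R}) (f : T -> \bar R) :
  measurable_fun setT f -> (forall x, 0 <= f x) ->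
  exists nu : {measure set T -> \bar R}, is_density nu mu f.
Proof.
move=> mf f0; pose nu (A : set T) := \int[mu]_(x in A) f x.
have nu0 : nu set0 = 0 by rewrite /nu integral_set0.
have nu_ge0 A : 0 <= nu A by exact: integral_ge0.
have nu_sigma : semi_sigma_additive nu.
  move=> F mF tF mUF.
  have -> : nu (\bigcup_n F n) = \sum_(i <oo) nu (F i).
    by rewrite /nu ge0_integral_bigcup//; exact: measurable_funTS.
  exact: is_cvg_nneseries.
pose M := isMeasure.Build _ _ _ nu nu0 nu_ge0 nu_sigma.
pose nuM : {measure set T -> \bar R} := HB.pack nu M.
by exists nuM.
Qed.

Lemma density_probability (mu : {measure set T -> \bar R}) (f : T -> \bar R) :
  measurable_fun setT f -> (forall x, 0 <= f x) -> \int[mu]_x f x = 1 ->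
  exists nu : probability T R, is_density nu mu f.
Proof.
move=> mf f0 f1; have [nu nuf] := density_measure mu mf f0.
have nu1 : nu setT = 1 by have [_ _ fE] := nuf; rewrite fE.
pose nu' : set T -> \bar R := nu.
pose M := isMeasure.Build _ _ _ nu' (measure0 nu) (measure_ge0 nu)
  (@measure_semi_sigma_additive _ _ _ nu).
pose nuM : {measure set T -> \bar R} := HB.pack nu' M.
pose N := Measure_isProbability.Build _ _ _ nuM nu1.
pose nuP : probability T R := HB.pack nu' M N.
by exists nuP.
Qed.

End entropy.

(** * The Schrödinger map and its contraction property *)

Section schrodinger_map.
Context dX dY (X : measurableType dX) (Y : measurableType dY) (R : realType).
Variables (nu : probability Y R) (k : X -> Y -> R) (a b : R).

Definition positive_integrable d (T : measurableType d)
    (P : set T -> \bar R) (g : T -> R) : Prop :=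
  [/\ measurable_fun setT g, (forall y, 0 < g y) &
      P.-integrable setT (EFin \o g)].

Definition schrodinger_map (g : Y -> R) (x : X) : R :=
  (\int[nu]_y (k x y * g y))^-1.

Hypotheses (mk : measurable_fun setT (fun z : X * Y => k z.1 z.2))
  (a_gt0 : 0 < a) (ab : a < b) (kab : forall x y, a <= k x y <= b).

Let mk1 x : measurable_fun setT (k x).
Proof. exact: measurableT_comp mk (measurable_pair1 x). Qed.

Let b_gt0 : 0 < b. Proof. exact: lt_trans ab. Qed.

Let k_ge0 x y : 0 <= k x y.
Proof. by have /andP[+ _] := kab x y; apply: le_trans; exact: ltW. Qed.

Lemma integrable_kernelM g x : nu.-integrable setT (EFin \o g) ->
  nu.-integrable setT (fun y => (k x y * g y)%:E).
Proof.
move=> ig; have /integrableP[/measurable_EFinP mg _] := ig.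
apply: (@le_integrable _ _ _ nu setT measurableT _ (fun y => b%:E * (g y)%:E)%E).
- by apply/measurable_EFinP; exact: measurable_funM.
- move=> y _ /=; rewrite !normrM lee_fin ler_wpM2r// ger0_norm// ger0_norm.
    by have /andP[] := kab x y.
  exact: ltW.
- exact: integrableZl.
Qed.

Lemma Rintegral_kernel_bounds g x : nu.-integrable setT (EFin \o g) ->
  (forall y, 0 <= g y) ->
  a * \int[nu]_y g y <= \int[nu]_y (k x y * g y) <= b * \int[nu]_y g y.
Proof.
move=> ig g0; have ikg := integrable_kernelM x ig.
by rewrite -!RintegralZl//; apply/andP; split; apply: le_Rintegral => //;
  try exact: (integrableZl measurableT _ ig); move=> y _;
  rewrite ler_wpM2r//; have /andP[] := kab x y.
Qed.

(** A positive function with zero integral would vanish almost everywhere, on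
    a space of mass 1. *)
Lemma Rintegral_gt0 g : positive_integrable nu g -> 0 < \int[nu]_y g y.
Proof.
move=> [mg g0 ig]; rewrite lt_def Rintegral_ge0 ?andbT; last first.
  by move=> y _; exact: ltW.
apply/negP => /eqP I0.
have : (\int[nu]_y `|(g y)%:E| = 0)%E.
  under eq_integral do rewrite gee0_abs ?lee_fin ?ltW//.
  by rewrite -(fineK (integrable_fin_num measurableT ig)) -/(Rintegral _ _ _) I0.
move/(ae_eq_integral_abs nu measurableT (measurable_int _ ig)).
move=> [N [mN N0 gN]].
have /eqP : nu setT = 0.
  rewrite -N0; congr (nu _); apply/seteqP; split=> // y _; apply: gN => /= H.
  by have [] := H I => /eqP; rewrite gt_eqF.
by rewrite probability_setT onee_eq0.
Qed.

Lemma Rintegral_kernel_gt0 g x : positive_integrable nu g ->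
  0 < \int[nu]_y (k x y * g y).
Proof.
move=> gP; have [_ g0 ig] := gP.
have /andP[+ _] := Rintegral_kernel_bounds x ig (fun y => ltW (g0 y)).
by apply: lt_le_trans; rewrite mulr_gt0// Rintegral_gt0.
Qed.

Lemma schrodinger_map_bounds g x : positive_integrable nu g ->
  (b * \int[nu]_y g y)^-1 <= schrodinger_map g x <= (a * \int[nu]_y g y)^-1.
Proof.
move=> gP; have [_ g0 ig] := gP.
have /andP[lo hi] := Rintegral_kernel_bounds x ig (fun y => ltW (g0 y)).
have I0 := Rintegral_gt0 gP; have K0 := Rintegral_kernel_gt0 x gP.
by rewrite !lef_pV2 ?posrE// ?lo ?hi// mulr_gt0.
Qed.

Lemma measurable_schrodinger_map g : positive_integrable nu g ->
  measurable_fun setT (schrodinger_map g).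
Proof.
move=> [mg g0 ig]; apply: measurableT_comp; first exact: measurable_invr.
apply: measurableT_comp; first exact: fine_measurable.
apply: (measurable_fun_fubini_tonelli_F (fun z : X * Y => (k z.1 z.2 * g z.2)%:E)).
- apply/measurable_EFinP; apply: measurable_funM => //.
  exact: measurableT_comp mg measurable_snd.
- by move=> z; rewrite lee_fin mulr_ge0// ltW.
Qed.

Lemma schrodinger_map_positive (P : probability X R) g :
  positive_integrable nu g -> positive_integrable P (schrodinger_map g).
Proof.
move=> gP; have mS := measurable_schrodinger_map gP.
have S0 x : 0 < schrodinger_map g x by rewrite invr_gt0 Rintegral_kernel_gt0.
split => //; apply: measurable_bounded_integrable => //.
  exact: probability_lty.
exists (a * \int[nu]_y g y)^-1; split; first by rewrite num_real.
move=> M hM x _ /=; rewrite gtr0_norm//; apply: ltW; apply: le_lt_trans hM.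
by have /andP[] := schrodinger_map_bounds x gP.
Qed.

(** With h the quotient of the integrals of [g'] and [g], the new ends are p'
    = p + (a / b) (h - p) and q' = q - (a / b) (q - h): all the averages of g'
    / g with weights proportional to k(x, .) g have the common component (a /
    b) h. The inequality on maps reverses the roles of [g] and [g'], which is
    what allows the lemma to be iterated. *)
Lemma schrodinger_map_contraction g g' (p q : R) :
  positive_integrable nu g -> positive_integrable nu g' ->
  (forall y, p * g y <= g' y <= q * g y) ->
  exists p' q', [/\ p <= p', q' <= q, q' - p' = (1 - a / b) * (q - p) &
    forall x, p' * schrodinger_map g' x <= schrodinger_map g x
                <= q' * schrodinger_map g' x].
Proof.
move=> gP g'P pq; have [_ g0 ig] := gP; have [_ g'0 ig'] := g'P.
have I0 := Rintegral_gt0 gP; set J := \int[nu]_y g y in I0.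
pose h := \int[nu]_y g' y / J.
have d0 : 0 <= a / b by rewrite divr_ge0// ltW.
have ipg c : nu.-integrable setT (EFin \o (fun y => c * g y)).
  exact: (integrableZl measurableT c ig).
(* The kernel dominates a times the integral on the two nonnegative functions
   g' - p g and q g - g'. *)
have lo x : a * (\int[nu]_y g' y - p * J) <=
    \int[nu]_y (k x y * g' y) - p * \int[nu]_y (k x y * g y).
  have i1 : nu.-integrable setT (EFin \o (fun y => g' y - p * g y)).
    exact: (integrableB measurableT ig' (ipg p)).
  have /andP[+ _] := @Rintegral_kernel_bounds (fun y => g' y - p * g y) x i1
    (fun y => ltac:(by have /andP[] := pq y; rewrite subr_ge0)).
  rewrite RintegralB// RintegralZl//; move=> /le_trans; apply.
  rewrite -RintegralZl//; last exact: integrable_kernelM.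
  rewrite -RintegralB//; last 2 first.
  - exact: integrable_kernelM.
  - exact: (integrableZl measurableT p (integrable_kernelM x ig)).
  by under [leRHS]eq_Rintegral => y _ do rewrite mulrCA -mulrBr.
have hi x : a * (q * J - \int[nu]_y g' y) <=
    q * \int[nu]_y (k x y * g y) - \int[nu]_y (k x y * g' y).
  have i1 : nu.-integrable setT (EFin \o (fun y => q * g y - g' y)).
    exact: (integrableB measurableT (ipg q) ig').
  have /andP[+ _] := @Rintegral_kernel_bounds (fun y => q * g y - g' y) x i1
    (fun y => ltac:(by have /andP[] := pq y; rewrite subr_ge0)).
  rewrite RintegralB// RintegralZl//; move=> /le_trans; apply.
  rewrite -RintegralZl//; last exact: integrable_kernelM.
  rewrite -RintegralB//; last 2 first.
  - exact: (integrableZl measurableT q (integrable_kernelM x ig)).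
  - exact: integrable_kernelM.
  by under [leRHS]eq_Rintegral => y _ do rewrite mulrCA -mulrBr.
have ph : p <= h.
  rewrite ler_pdivlMr// -RintegralZl//; apply: le_Rintegral => //.
  by move=> y _; have /andP[] := pq y.
have hq : h <= q.
  rewrite ler_pdivrMr// -RintegralZl//; apply: le_Rintegral => //.
  by move=> y _; have /andP[] := pq y.
have hJ : \int[nu]_y g' y = h * J by rewrite divfK// gt_eqF.
exists (p + a / b * (h - p)), (q - a / b * (q - h)); split.
- by rewrite lerDl mulr_ge0// subr_ge0.
- by rewrite gerBl mulr_ge0// subr_ge0.
- ring.
move=> x; have A0 := Rintegral_kernel_gt0 x gP.
have A0' := Rintegral_kernel_gt0 x g'P.
have /andP[_ Ab] := Rintegral_kernel_bounds x ig (fun y => ltW (g0 y)).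
move: (lo x) (hi x); rewrite /schrodinger_map hJ -/J.
move: A0 A0' Ab; rewrite -/J; set A := \int[nu]_y (k x y * g y).
set A' := \int[nu]_y (k x y * g' y).
move=> A0 A0' Ab lox hix.
have key c : 0 <= c -> a / b * c * A <= a * (c * J).
  move=> c0; rewrite -mulrA -mulrA ler_pM2l// mulrCA ler_wpM2l//.
  by rewrite mulrC ler_pdivrMr// mulrC.
have k1 := key (h - p) ltac:(by rewrite subr_ge0).
have k2 := key (q - h) ltac:(by rewrite subr_ge0).
apply/andP; split.
  by rewrite ler_pdivrMr// [leRHS]mulrC ler_pdivlMr//; lra.
by rewrite ler_pdivlMr// [leLHS]mulrC ler_pdivrMr//; lra.
Qed.

End schrodinger_map.

(** * Couplings given by a density *)

Section product_integrals.
Context dX dY (X : measurableType dX) (Y : measurableType dY) (R : realType).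
Variables (rho : probability X R) (mu : probability Y R).
Local Open Scope ereal_scope.

Lemma ge0_integral_setXT (h : X * Y -> \bar R) A :
  measurable_fun setT h -> (forall z, 0 <= h z) -> measurable A ->
  \int[rho \x mu]_(z in A `*` setT) h z = \int[rho]_(x in A) \int[mu]_y h (x, y).
Proof.
move=> mh h0 mA; rewrite integral_mkcond fubini_tonelli1//; last 2 first.
- apply/(measurable_restrictT _ _).1 => //; first exact: measurableX.
  exact: measurable_funTS.
- by move=> z; exact: erestrict_ge0.
rewrite [RHS]integral_mkcond; apply: eq_integral => x _.
rewrite /fubini_F [RHS]patchE; case: ifPn => xA.
  apply: eq_integral => y _; rewrite patchE mem_set//; split => //=.
  exact: set_mem.
apply: integral0_eq => y _; rewrite patchE memNset// => -[/= xA' _].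
by move: xA; rewrite notin_setE.
Qed.

Lemma ge0_integral_setTX (h : X * Y -> \bar R) B :
  measurable_fun setT h -> (forall z, 0 <= h z) -> measurable B ->
  \int[rho \x mu]_(z in setT `*` B) h z = \int[mu]_(y in B) \int[rho]_x h (x, y).
Proof.
move=> mh h0 mB; rewrite integral_mkcond fubini_tonelli1//; last 2 first.
- apply/(measurable_restrictT _ _).1 => //; first exact: measurableX.
  exact: measurable_funTS.
- by move=> z; exact: erestrict_ge0.
rewrite fubini_tonelli//; last 2 first.
- apply/(measurable_restrictT _ _).1 => //; first exact: measurableX.
  exact: measurable_funTS.
- by move=> z; exact: erestrict_ge0.
rewrite [RHS]integral_mkcond; apply: eq_integral => y _.
rewrite /fubini_G [RHS]patchE; case: ifPn => yB.
  apply: eq_integral => x _; rewrite patchE mem_set//; split => //=.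
  exact: set_mem.
apply: integral0_eq => x _; rewrite patchE memNset// => -[_ /= yB'].
by move: yB; rewrite notin_setE.
Qed.

Lemma is_coupling_density (gam : set (X * Y) -> \bar R) (h : X * Y -> \bar R) :
  is_density gam (rho \x mu) h ->
  (forall x, \int[mu]_y h (x, y) = 1) -> (forall y, \int[rho]_x h (x, y) = 1) ->
  is_coupling rho mu gam.
Proof.
move=> [mh h0 hE] h1 h2; split=> A mA; rewrite hE; try exact: measurableX.
- rewrite ge0_integral_setXT//; under eq_integral do rewrite h1.
  by rewrite integral_cst// mul1e.
- rewrite ge0_integral_setTX//; under eq_integral do rewrite h2.
  by rewrite integral_cst// mul1e.
Qed.

Lemma coupling_integral_fst (gam : probability (X * Y)%type R) (f : X -> R) :
  is_coupling rho mu gam -> measurable_fun setT f ->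
  gam.-integrable setT (fun z => (f z.1)%:E) ->
  \int[gam]_z (f z.1)%:E = \int[rho]_x (f x)%:E.
Proof.
move=> [gA _] mf fi.
rewrite -(@integral_pushforward _ _ _ _ _ fst measurable_fst gam setT
  (EFin \o f))//.
- by apply: eq_integral_measure => A mA; rewrite -gA// setXT.
- exact/measurable_EFinP.
Qed.

Lemma coupling_integral_snd (gam : probability (X * Y)%type R) (f : Y -> R) :
  is_coupling rho mu gam -> measurable_fun setT f ->
  gam.-integrable setT (fun z => (f z.2)%:E) ->
  \int[gam]_z (f z.2)%:E = \int[mu]_y (f y)%:E.
Proof.
move=> [_ gB] mf fi.
rewrite -(@integral_pushforward _ _ _ _ _ snd measurable_snd gam setT
  (EFin \o f))//.
- by apply: eq_integral_measure => A mA; rewrite -gB// setTX.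
- exact/measurable_EFinP.
Qed.

End product_integrals.

Section bounded_positive.
Context d (T : measurableType d) (R : realType).

Definition bounded_positive (f : T -> R) : Prop :=
  measurable_fun setT f /\
  exists lo hi : R, 0 < lo /\ forall x, lo <= f x <= hi.

Lemma bounded_positive_gt0 f : bounded_positive f -> forall x, 0 < f x.
Proof.
by move=> [_ [lo [hi [lo0 fb]]]] x; have /andP[+ _] := fb x; exact: lt_le_trans.
Qed.

Lemma bounded_positive_ln_integrable (P : probability T R) f :
  bounded_positive f -> P.-integrable setT (EFin \o (@ln R \o f)).
Proof.
move=> fP; have [mf [lo [hi [lo0 fb]]]] := fP.
apply: measurable_bounded_integrable => //; first exact: probability_lty.
  exact: measurableT_comp (@measurable_ln R) mf.
exists (`|ln lo| + `|ln hi|); split; first by rewrite num_real.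
move=> M hM x _ /=; apply: ltW; apply: le_lt_trans hM.
have /andP[l1 l2] := fb x; have f0 := bounded_positive_gt0 fP x.
have hi0 := lt_le_trans f0 l2.
have {}l1 : ln lo <= ln (f x) by rewrite ler_ln.
have {}l2 : ln (f x) <= ln hi by rewrite ler_ln.
rewrite ler_norml; have := ler_norm (ln hi); have := ler_norm (- ln lo).
have := normr_ge0 (ln lo); have := normr_ge0 (ln hi); rewrite normrN; lra.
Qed.

Lemma bounded_positiveM f g : bounded_positive f -> bounded_positive g ->
  bounded_positive (fun x => f x * g x).
Proof.
move=> fP gP; have [mf [l [h [l0 fb]]]] := fP; have [mg [l' [h' [l'0 gb]]]] := gP.
split; first exact: measurable_funM.
exists (l * l'), (h * h'); split; first exact: mulr_gt0.
move=> x; have /andP[f1 f2] := fb x; have /andP[g1 g2] := gb x.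
by apply/andP; split; apply: ler_pM => //; apply: ltW => //;
  exact: bounded_positive_gt0.
Qed.

End bounded_positive.

Lemma bounded_positive_comp d d' (T : measurableType d) (U : measurableType d')
    (R : realType) (f : U -> R) (e : T -> U) :
  measurable_fun setT e -> bounded_positive f -> bounded_positive (f \o e).
Proof.
move=> me [mf [lo [hi [lo0 fb]]]]; split; first exact: measurableT_comp mf me.
by exists lo, hi; split => // x; exact: fb.
Qed.

(** * Entropic cost and optimality *)

Section optimal_coupling.
Context dX dY (X : measurableType dX) (Y : measurableType dY) (R : realType).
Variables (rho : probability X R) (mu : probability Y R) (k : X -> Y -> R).
Hypothesis kP : bounded_positive (fun z : X * Y => k z.1 z.2).
Local Open Scope ereal_scope.

Definition entropic_cost (gam : set (X * Y) -> \bar R) : \bar R :=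
  rel_entropy gam (rho \x mu) + \int[gam]_z (- lne (k z.1 z.2)%:E).

Lemma lne_kernel z : lne (k z.1 z.2)%:E = (ln (k z.1 z.2))%:E.
Proof. by rewrite lne_EFin//; exact: (bounded_positive_gt0 kP z). Qed.

Lemma entropic_cost_fin (gam : probability (X * Y)%type R) :
  entropic_cost gam = rel_entropy gam (rho \x mu) -
    \int[gam]_z (ln (k z.1 z.2))%:E /\
  \int[gam]_z (ln (k z.1 z.2))%:E \is a fin_num.
Proof.
have ki := bounded_positive_ln_integrable gam kP.
split; last exact: (integrable_fin_num measurableT ki).
rewrite /entropic_cost; congr (_ + _).
rewrite -integralN; first by apply: eq_integral => z _; rewrite lne_kernel.
by rewrite fin_num_adde_defl//; have := integrable_neg_fin_num measurableT ki;
  rewrite ?fin_numN.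
Qed.

Variables (F : X -> R) (G : Y -> R) (be : {measure set (X * Y) -> \bar R}).
Hypotheses (FP : bounded_positive F) (GP : bounded_positive G)
  (be_density : is_density be (rho \x mu)
     (fun z => (F z.1 * k z.1 z.2 * G z.2)%:E)).

Let wP : bounded_positive (fun z : X * Y => F z.1 * k z.1 z.2 * G z.2)%R.
Proof.
apply: bounded_positiveM; first apply: bounded_positiveM => //.
- exact: bounded_positive_comp measurable_fst FP.
- exact: bounded_positive_comp measurable_snd GP.
Qed.

(** The logarithm of the density F(x) k(x, y) G(y) of [be] splits into the
    cost, with the opposite sign, and two functions of one variable, whose
    integrals depend on the marginals only. So minimizing the cost over
    couplings amounts to minimizing the relative entropy with respect to [be]. *)
Lemma entropic_cost_coupling (gam : probability (X * Y)%type R) f :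
  is_coupling rho mu gam -> is_density gam (rho \x mu) f ->
  (forall z, f z \is a fin_num) -> rel_entropy gam (rho \x mu) < +oo ->
  entropic_cost gam = rel_entropy gam be +
    (\int[rho]_x (ln (F x))%:E + \int[mu]_y (ln (G y))%:E).
Proof.
move=> cg gf ffin fin; have [-> kfin] := entropic_cost_fin gam.
have FP' := bounded_positive_comp (@measurable_fst _ _ X Y) FP.
have GP' := bounded_positive_comp (@measurable_snd _ _ X Y) GP.
have iF := bounded_positive_ln_integrable gam FP'.
have iG := bounded_positive_ln_integrable gam GP'.
have ik := bounded_positive_ln_integrable gam kP.
have goo := probability_lty gam.
rewrite (rel_entropy_change goo gf be_density wP.1 (bounded_positive_gt0 wP)
  (integrable_lne_density goo gf ffin fin)
  (bounded_positive_ln_integrable gam wP)).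
rewrite -addeA; congr (_ + _).
have -> : \int[gam]_z (ln (F z.1 * k z.1 z.2 * G z.2))%:E =
    \int[gam]_z (ln (F z.1))%:E + \int[gam]_z (ln (k z.1 z.2))%:E +
    \int[gam]_z (ln (G z.2))%:E.
  rewrite -(integralD _ iF ik)//.
  have iFk := integrableD measurableT iF ik.
  rewrite -(integralD _ iFk iG)//.
  apply: eq_integral => z _ /=.
  have F0 := bounded_positive_gt0 FP z.1; have G0 := bounded_positive_gt0 GP z.2.
  have k0 := bounded_positive_gt0 kP z.
  by rewrite !lnM ?posrE ?mulr_gt0.
rewrite (@coupling_integral_fst _ _ _ _ _ rho mu gam (@ln R \o F) cg _ iF); last first.
  exact: measurableT_comp (@measurable_ln R) FP.1.
rewrite (@coupling_integral_snd _ _ _ _ _ rho mu gam (@ln R \o G) cg _ iG); last first.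
  exact: measurableT_comp (@measurable_ln R) GP.1.
by rewrite addeAC addeK.
Qed.

(** By [entropic_cost_coupling] the entropy of [gam] with respect to [be] is
    at most that of the competitor [gam'], whose density with respect to [be]
    is at most [c]. That the entropy of [gam] with respect to the product is
    finite, so that the formula applies to [gam], also comes from the
    comparison. *)
Lemma optimal_rel_entropy_le (gam gam' : probability (X * Y)%type R)
    (f' : X * Y -> R) (c : R) :
  is_coupling rho mu gam -> is_coupling rho mu gam' ->
  entropic_cost gam <= entropic_cost gam' ->
  is_density gam' (rho \x mu) (EFin \o f') -> (1 <= c)%R ->
  (forall z, f' z <= c * (F z.1 * k z.1 z.2 * G z.2))%R ->
  rel_entropy gam be <= (ln c)%:E.
Proof.
move=> cg cg' opt gf' c1 f'c.
have w0 := bounded_positive_gt0 wP.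
have H' : rel_entropy gam' be <= (ln c)%:E.
  apply: (rel_entropy_le_ln (is_density_div gf' be_density wP.1 w0)) => // z.
  by rewrite /= -EFinM lee_fin ler_pdivrMr// f'c.
have fin' : rel_entropy gam' (rho \x mu) < +oo.
  have [_ [lo [hi [lo0 wb]]]] := wP.
  apply: (@le_lt_trans _ _ (ln (Num.max 1 (c * hi)))%:E); last by rewrite ltry.
  apply: (rel_entropy_le_ln gf'); first by rewrite le_max lexx.
  move=> z /=; rewrite lee_fin le_max; apply/orP; right.
  apply: le_trans (f'c z) _; rewrite ler_wpM2l ?(le_trans ler01)//.
  by have /andP[] := wb z.
set K := (\int[rho]_x (ln (F x))%:E + \int[mu]_y (ln (G y))%:E).
have Kfin : K \is a fin_num.
  rewrite fin_numD; apply/andP; split; apply: integrable_fin_num => //;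
  exact: bounded_positive_ln_integrable.
have J' := entropic_cost_coupling cg' gf' (fun _ => erefl) fin'.
rewrite -/K in J'.
have [Jg kfin] := entropic_cost_fin gam.
have fin : rel_entropy gam (rho \x mu) < +oo.
  have : entropic_cost gam < +oo.
    apply: le_lt_trans opt _; rewrite J'.
    apply: (@le_lt_trans _ _ ((ln c)%:E + K)); first exact: leeD.
    by rewrite -(fineK Kfin) -EFinD ltry.
  by rewrite Jg lteBlDr// addye//; move: kfin; rewrite fin_numE => /andP[].
have dom : gam `<< (rho \x mu).
  by move: fin; rewrite /rel_entropy; case: asboolP.
pose pi : probability (X * Y)%type R := (rho \x mu).
have [f [f0 ffin fi fE]] := @radon_nikodym_sigma_finite _ _ _ pi gam dom.
have gf : is_density gam (rho \x mu) f by split=> //; exact: measurable_int fi.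
have J := entropic_cost_coupling cg gf ffin fin; rewrite -/K in J.
apply: le_trans H'.
by move: opt; rewrite J J' leeD2rE.
Qed.

End optimal_coupling.

(** * Geometric convergence for a kernel bounded above and below *)

Section sinkhorn_rate.
Context dX dY (X : measurableType dX) (Y : measurableType dY) (R : realType).
Variables (rho : probability X R) (mu : probability Y R)
  (k : X -> Y -> R) (a b : R).
Hypotheses (mk : measurable_fun setT (fun z : X * Y => k z.1 z.2))
  (a_gt0 : 0 < a) (ab : a < b) (kab : forall x y, a <= k x y <= b).
Variables (g0 : Y -> R).
Hypothesis g0P : positive_integrable mu g0.

Let kT y x := k x y.
Let mkT : measurable_fun setT (fun z : Y * X => kT z.1 z.2).
Proof. exact: (measurableT_comp mk (@measurable_swap _ _ Y X)). Qed.
Let kTab y x : a <= kT y x <= b. Proof. exact: kab. Qed.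
Let b_gt0 : 0 < b. Proof. exact: lt_trans ab. Qed.

Fixpoint sinkhorn_G (n : nat) : Y -> R :=
  if n is n'.+1
  then schrodinger_map rho (fun y x => k x y) (schrodinger_map mu k (sinkhorn_G n'))
  else g0.

Definition sinkhorn_F (n : nat) : X -> R := schrodinger_map mu k (sinkhorn_G n).

Lemma sinkhorn_G_positive n : positive_integrable mu (sinkhorn_G n).
Proof.
elim: n => [//|n IH] /=.
apply: (schrodinger_map_positive mkT a_gt0 ab kTab).
exact: (schrodinger_map_positive mk a_gt0 ab kab).
Qed.

Lemma sinkhorn_F_positive n : positive_integrable rho (sinkhorn_F n).
Proof.
exact: (schrodinger_map_positive mk a_gt0 ab kab rho (sinkhorn_G_positive n)).
Qed.

Lemma sinkhorn_GS_bounds n y :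
  (b * \int[rho]_x sinkhorn_F n x)^-1 <= sinkhorn_G n.+1 y <=
  (a * \int[rho]_x sinkhorn_F n x)^-1.
Proof.
exact: (schrodinger_map_bounds mkT a_gt0 ab kTab y (sinkhorn_F_positive n)).
Qed.

Lemma sinkhorn_F_bounds n x :
  (b * \int[mu]_y sinkhorn_G n y)^-1 <= sinkhorn_F n x <=
  (a * \int[mu]_y sinkhorn_G n y)^-1.
Proof.
exact: (schrodinger_map_bounds mk a_gt0 ab kab x (sinkhorn_G_positive n)).
Qed.

Lemma sinkhorn_F_bounded n : bounded_positive (sinkhorn_F n).
Proof.
have [mF _ _] := sinkhorn_F_positive n; split=> //.
exists (b * \int[mu]_y sinkhorn_G n y)^-1, (a * \int[mu]_y sinkhorn_G n y)^-1.
split; last exact: sinkhorn_F_bounds.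
by rewrite invr_gt0 mulr_gt0// Rintegral_gt0//; exact: sinkhorn_G_positive.
Qed.

Lemma sinkhorn_GS_bounded n : bounded_positive (sinkhorn_G n.+1).
Proof.
have [mF _ _] := sinkhorn_G_positive n.+1; split=> //.
exists (b * \int[rho]_x sinkhorn_F n x)^-1, (a * \int[rho]_x sinkhorn_F n x)^-1.
split; last exact: sinkhorn_GS_bounds.
by rewrite invr_gt0 mulr_gt0// Rintegral_gt0//; exact: sinkhorn_F_positive.
Qed.

Let kP : bounded_positive (fun z : X * Y => k z.1 z.2).
Proof. by split=> //; exists a, b; split => // z; exact: kab. Qed.

(** The induction starts at [sinkhorn_G 1], because [g0] may fail to be
    bounded away from 0 and infinity. *)
Lemma sinkhorn_G_ratio : exists2 D : R, 0 <= D & forall n, exists p q,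
  [/\ 0 < p, (forall y, p * sinkhorn_G n.+2 y <= sinkhorn_G n.+1 y
                          <= q * sinkhorn_G n.+2 y) &
      q - p <= D * ((1 - a / b) ^+ 2) ^+ n].
Proof.
have [_ [l1 [h1 [l10 G1]]]] := sinkhorn_GS_bounded 0.
have [_ [l2 [h2 [l20 G2]]]] := sinkhorn_GS_bounded 1.
have [[p0 h10] h20] : (0 < l1 / h2 /\ 0 < h1) /\ 0 < h2.
  have [y _] : [set: Y] !=set0.
    apply/set0P/eqP => Y0; have := @probability_setT _ _ _ mu.
    by rewrite Y0 measure0 => /esym/eqP; rewrite onee_eq0.
  have /andP[l1G Gh1] := G1 y; have /andP[l2G Gh2] := G2 y.
  have h2_gt0 : 0 < h2 by rewrite (lt_le_trans l20)// (le_trans l2G).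
  by rewrite divr_gt0//; split=> //; rewrite (lt_le_trans l10)// (le_trans l1G).
exists (`|h1 / l2 - l1 / h2|) => //.
elim=> [|n [p [q [p_gt0 pq qp]]]].
  exists (l1 / h2), (h1 / l2); split=> //; last by rewrite expr0 mulr1 ler_norm.
  move=> y; have /andP[l1G Gh1] := G1 y; have /andP[l2G Gh2] := G2 y.
  apply/andP; split; [apply: le_trans l1G|apply: le_trans Gh1 _].
    by rewrite mulrAC ler_pdivrMr// ler_wpM2l// ltW.
  by rewrite mulrAC ler_pdivlMr// ler_wpM2l// ltW.
have [p' [q' [pp' qq' qp' F']]] := schrodinger_map_contraction mk a_gt0 ab kab
  (sinkhorn_G_positive n.+2) (sinkhorn_G_positive n.+1) pq.
have [p2 [q2 [pp2 qq2 qp2 G']]] := schrodinger_map_contraction mkT a_gt0 ab kTab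
  (sinkhorn_F_positive n.+1) (sinkhorn_F_positive n.+2) F'.
exists p2, q2; split=> //; first by rewrite (lt_le_trans p_gt0)// (le_trans pp').
rewrite qp2 qp' mulrA -expr2; set t := (1 - a / b) ^+ 2 in qp *.
rewrite [t ^+ n.+1]exprS mulrCA ler_wpM2l//.
by rewrite exprn_ge0// subr_ge0 ler_pdivrMr// mul1r ltW.
Qed.

Definition sinkhorn_density n n' (z : X * Y) : R :=
  sinkhorn_F n z.1 * k z.1 z.2 * sinkhorn_G n' z.2.

(** Each of the three factors is bounded below by means of the integrals of
    [sinkhorn_G n.+1] and [sinkhorn_F n], and these cancel: the bound is
    uniform in [n]. *)
Lemma sinkhorn_density_ge n z : (a / b) ^+ 2 <= sinkhorn_density n.+1 n.+1 z.
Proof.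
set J := \int[rho]_x sinkhorn_F n x.
have J0 : 0 < J := Rintegral_gt0 (sinkhorn_F_positive n).
have GP := sinkhorn_G_positive n.+1; have [_ _ iG] := GP.
have I0 := Rintegral_gt0 GP.
have I_le : \int[mu]_y sinkhorn_G n.+1 y <= (a * J)^-1.
  have -> : (a * J)^-1 = \int[mu]_y cst (a * J)^-1 y.
    rewrite Rintegral_cst// [fine _](_ : _ = 1) ?mulr1//.
    by rewrite [X in fine X](@probability_setT _ _ _ mu).
  apply: le_Rintegral => //; first exact: finite_measure_integrable_cst.
  by move=> y _; have /andP[] := sinkhorn_GS_bounds n y.
have /andP[Flo _] := sinkhorn_F_bounds n.+1 z.1.
have /andP[Glo _] := sinkhorn_GS_bounds n z.2.
have /andP[klo _] := kab z.1 z.2.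
have F_ge : a * J / b <= sinkhorn_F n.+1 z.1.
  apply: le_trans Flo; rewrite invfM mulrC ler_pM2l ?invr_gt0//.
  by rewrite -[leLHS]invrK lef_pV2 ?posrE// invr_gt0 mulr_gt0.
have -> : (a / b) ^+ 2 = a * J / b * a * (b * J)^-1.
  by field; rewrite !gt_eqF.
rewrite /sinkhorn_density ler_pM//.
- by rewrite !mulr_ge0// ?invr_ge0 ltW.
- by rewrite invr_ge0 mulr_ge0// ltW.
- by rewrite ler_pM// ?divr_ge0 ?mulr_ge0// ltW.
Qed.

(** The density with respect to [mu] of the second marginal of the half-step
    coupling. *)
Definition half_marginal n y := sinkhorn_G n y / sinkhorn_G n.+1 y.

Lemma sinkhorn_density_ge0 n n' z : 0 <= sinkhorn_density n n' z.
Proof.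
have [_ F0 _] := sinkhorn_F_positive n; have [_ G0 _] := sinkhorn_G_positive n'.
by rewrite !mulr_ge0// ltW//; exact: (bounded_positive_gt0 kP z).
Qed.

Lemma measurable_sinkhorn_density n n' :
  measurable_fun setT (sinkhorn_density n n').
Proof.
have [mF _ _] := sinkhorn_F_positive n; have [mG _ _] := sinkhorn_G_positive n'.
apply: measurable_funM; first apply: measurable_funM => //.
- exact: measurableT_comp mF measurable_fst.
- exact: measurableT_comp mG measurable_snd.
Qed.

Lemma sinkhorn_density_integral_y n x :
  (\int[mu]_y (sinkhorn_density n n (x, y))%:E = 1)%E.
Proof.
have GP := sinkhorn_G_positive n; have [_ _ iG] := GP.
have ikG := integrable_kernelM mk a_gt0 ab kab x iG.
under eq_integral do rewrite /sinkhorn_density/= -mulrA EFinM.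
rewrite integralZl// -(fineK (integrable_fin_num measurableT ikG)) -EFinM.
rewrite mulVf// gt_eqF//.
exact: (Rintegral_kernel_gt0 mk a_gt0 ab kab x GP).
Qed.

Lemma sinkhorn_density_integral_x n y :
  (\int[rho]_x (sinkhorn_density n n (x, y))%:E = (half_marginal n y)%:E)%E.
Proof.
have FP := sinkhorn_F_positive n; have [_ _ iF] := FP.
have ikF := integrable_kernelM mkT a_gt0 ab kTab y iF.
under eq_integral do rewrite /sinkhorn_density/= mulrC [X in _ * X]mulrC EFinM.
rewrite integralZl// -(fineK (integrable_fin_num measurableT ikF)) -EFinM.
by rewrite /half_marginal /= invrK.
Qed.


Lemma sinkhorn_full_integral_x n y :
  (\int[rho]_x (sinkhorn_density n n.+1 (x, y))%:E = 1)%E.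
Proof.
have FP := sinkhorn_F_positive n; have [_ _ iF] := FP.
have ikF := integrable_kernelM mkT a_gt0 ab kTab y iF.
under eq_integral do rewrite /sinkhorn_density/= mulrC [X in _ * X]mulrC EFinM.
rewrite integralZl// -(fineK (integrable_fin_num measurableT ikF)) -EFinM.
rewrite mulVf// gt_eqF//.
exact: (Rintegral_kernel_gt0 mkT a_gt0 ab kTab y FP).
Qed.

Lemma integral_sinkhorn_half n :
  (\int[rho \x mu]_z (sinkhorn_density n n z)%:E = 1)%E.
Proof.
rewrite fubini_tonelli1//; last 2 first.
- by apply/measurable_EFinP; exact: measurable_sinkhorn_density.
- by move=> z; rewrite lee_fin sinkhorn_density_ge0.
rewrite /fubini_F; under eq_integral do rewrite sinkhorn_density_integral_y.
by rewrite integral_cst// mul1e [LHS](@probability_setT _ _ _ rho).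
Qed.

Lemma integral_sinkhorn_full n :
  (\int[rho \x mu]_z (sinkhorn_density n n.+1 z)%:E = 1)%E.
Proof.
have mw : measurable_fun setT (fun z => (sinkhorn_density n n.+1 z)%:E).
  by apply/measurable_EFinP; exact: measurable_sinkhorn_density.
have w0 z : (0 <= (sinkhorn_density n n.+1 z)%:E)%E.
  by rewrite lee_fin sinkhorn_density_ge0.
rewrite fubini_tonelli1// fubini_tonelli//.
rewrite /fubini_G; under eq_integral do rewrite sinkhorn_full_integral_x.
by rewrite integral_cst// mul1e [LHS](@probability_setT _ _ _ mu).
Qed.

Lemma measurable_half_marginal n : measurable_fun setT (half_marginal n).
Proof.
have [mG _ _] := sinkhorn_G_positive n.
have [mG' _ _] := sinkhorn_G_positive n.+1.
by apply: measurable_funM => //; exact: measurableT_comp measurable_invr mG'.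
Qed.

Lemma half_marginal_gt0 n y : 0 < half_marginal n y.
Proof.
have [_ G0 _] := sinkhorn_G_positive n; have [_ G0' _] := sinkhorn_G_positive n.+1.
exact: divr_gt0.
Qed.

(** The half-step coupling has mass 1, as its first marginal is [rho]. *)
Lemma integral_half_marginal n : (\int[mu]_y (half_marginal n y)%:E = 1)%E.
Proof.
under eq_integral do rewrite -sinkhorn_density_integral_x.
rewrite -(fubini_tonelli (m1 := rho) (m2 := mu)
  (fun z => (sinkhorn_density n n z)%:E)).
- rewrite /fubini_F; under eq_integral do rewrite sinkhorn_density_integral_y.
  by rewrite integral_cst// mul1e [LHS](@probability_setT _ _ _ rho).
- by apply/measurable_EFinP; exact: measurable_sinkhorn_density.
- by move=> z; rewrite lee_fin sinkhorn_density_ge0.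
Qed.

Lemma integral_half_marginal_compl n (c : R) : 0 <= c ->
  (forall y, c * half_marginal n y <= 1) ->
  (\int[mu]_y (1 - c * half_marginal n y)%:E = (1 - c)%:E)%E.
Proof.
move=> c0 cu; have mu_n := measurable_half_marginal n.
have : (\int[mu]_y (1 - c * half_marginal n y)%:E +
        \int[mu]_y (c * half_marginal n y)%:E = 1)%E.
  rewrite -ge0_integralD//.
  - under eq_integral do rewrite -EFinD subrK.
    by rewrite integral_cst// mul1e [LHS](@probability_setT _ _ _ mu).
  - by move=> y _; rewrite lee_fin subr_ge0.
  - apply/measurable_EFinP; apply: measurable_funB => //.
    exact: measurable_funM.
  - by move=> y _; rewrite lee_fin mulr_ge0// ltW// half_marginal_gt0.
  - by apply/measurable_EFinP; exact: measurable_funM.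
under [X in (_ + X)%E]eq_integral do rewrite EFinM.
rewrite ge0_integralZl_EFin//; last 2 first.
- by move=> y _; rewrite lee_fin ltW// half_marginal_gt0.
- exact/measurable_EFinP.
rewrite integral_half_marginal mule1 => H.
by rewrite EFinB -H addeK.
Qed.

(** The half-step coupling has the correct first marginal, and scaled by 1 / q
    its second marginal is below [mu]; the missing mass is restored by a
    product with [rho], which preserves the first marginal. The restored mass
    is at most q - p, and [sinkhorn_density_ge] compares it with the half-step
    coupling. *)
Lemma sinkhorn_competitor n (p q : R) : 0 < p ->
  (forall y, p * sinkhorn_G n.+2 y <= sinkhorn_G n.+1 y
               <= q * sinkhorn_G n.+2 y) ->
  p <= 1 <= q /\
  exists (gam : probability (X * Y)%type R) (f : X * Y -> R),
    [/\ is_coupling rho mu gam, is_density gam (rho \x mu)%E (EFin \o f) &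
        forall z, f z <= (1 + (q - p) / (a / b) ^+ 2) *
                         sinkhorn_density n.+1 n.+1 z].
Proof.
move=> p0 pq.
have [_ G'0 _] := sinkhorn_G_positive n.+2.
have upq y : p <= half_marginal n.+1 y <= q.
  rewrite /half_marginal; move: (pq y) (G'0 y).
  move: (sinkhorn_G n.+2 y) (sinkhorn_G n.+1 y) => A B pqy A0.
  by rewrite ler_pdivlMr// ler_pdivrMr.
have int1 (c : R) : (\int[mu]_y cst c%:E y = c%:E)%E.
  by rewrite integral_cst// [X in (_ * X)%E](@probability_setT _ _ _ mu) mule1.
have int2 (c : R) : (\int[rho]_x cst c%:E x = c%:E)%E.
  by rewrite integral_cst// [X in (_ * X)%E](@probability_setT _ _ _ rho) mule1.
have mu1 := measurable_half_marginal n.+1.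
have p1 : p <= 1.
  rewrite -lee_fin -(integral_half_marginal n.+1) -int1.
  apply: ge0_le_integral => //.
  - by move=> y _; rewrite lee_fin ltW.
  - exact/measurable_EFinP.
  - by move=> y _; rewrite lee_fin; have /andP[] := upq y.
have q1 : 1 <= q.
  rewrite -lee_fin -(integral_half_marginal n.+1) -int1.
  apply: ge0_le_integral => //.
  - by move=> y _; rewrite lee_fin ltW// half_marginal_gt0.
  - exact/measurable_EFinP.
  - by move=> y _; rewrite lee_fin; have /andP[] := upq y.
have q0 : 0 < q := lt_le_trans ltr01 q1.
split; first by rewrite p1.
(* The density of the competitor with respect to the product measure. *)
pose f z := q^-1 * sinkhorn_density n.+1 n.+1 z + (1 - q^-1 * half_marginal n.+1 z.2).
have qu y : q^-1 * half_marginal n.+1 y <= 1.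
  by rewrite mulrC ler_pdivrMr// mul1r; have /andP[] := upq y.
have qV0 : 0 <= q^-1 by rewrite invr_ge0 ltW.
have f0 z : 0 <= f z.
  by rewrite addr_ge0 ?subr_ge0// mulr_ge0// sinkhorn_density_ge0.
have mw := measurable_sinkhorn_density n.+1 n.+1.
have mw1 : measurable_fun setT (fun z => q^-1 * sinkhorn_density n.+1 n.+1 z).
  exact: measurable_funM.
have mu2 : measurable_fun setT (fun z : X * Y => 1 - q^-1 * half_marginal n.+1 z.2).
  apply: measurable_funB => //; apply: measurable_funM => //.
  exact: measurableT_comp mu1 measurable_snd.
have mf : measurable_fun setT f by exact: measurable_funD.
have fx x : (\int[mu]_y (f (x, y))%:E = 1)%E.
  rewrite /f; under eq_integral do rewrite EFinD.
  rewrite ge0_integralD//; last 4 first.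
  - by move=> y _; rewrite lee_fin mulr_ge0// sinkhorn_density_ge0.
  - by apply/measurable_EFinP; exact: (measurableT_comp mw1 (measurable_pair1 x)).
  - by move=> y _; rewrite lee_fin subr_ge0.
  - by apply/measurable_EFinP; exact: (measurableT_comp mu2 (measurable_pair1 x)).
  rewrite [X in (_ + X)%E]integral_half_marginal_compl//.
  under eq_integral do rewrite EFinM.
  rewrite ge0_integralZl_EFin//; last 2 first.
  - by move=> y _; rewrite lee_fin sinkhorn_density_ge0.
  - by apply/measurable_EFinP; exact: (measurableT_comp mw (measurable_pair1 x)).
  by rewrite sinkhorn_density_integral_y mule1 -EFinD addrC subrK.
have fy y : (\int[rho]_x (f (x, y))%:E = 1)%E.
  rewrite /f; under eq_integral do rewrite EFinD.
  rewrite ge0_integralD//; last 4 first.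
  - by move=> x _; rewrite lee_fin mulr_ge0// sinkhorn_density_ge0.
  - by apply/measurable_EFinP; exact: (measurableT_comp mw1 (measurable_pair2 y)).
  - by move=> x _; rewrite lee_fin subr_ge0.
  - by apply/measurable_EFinP; exact: (measurableT_comp mu2 (measurable_pair2 y)).
  rewrite [X in (_ + X)%E](int2 (1 - q^-1 * half_marginal n.+1 y)).
  under eq_integral do rewrite EFinM.
  rewrite ge0_integralZl_EFin//; last 2 first.
  - by move=> x _; rewrite lee_fin sinkhorn_density_ge0.
  - by apply/measurable_EFinP; exact: (measurableT_comp mw (measurable_pair2 y)).
  by rewrite sinkhorn_density_integral_x -EFinM -EFinD addrC subrK.
have f0E z : (0 <= (EFin \o f) z)%E by rewrite lee_fin.
have mfE : measurable_fun setT (EFin \o f) by apply/measurable_EFinP.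
have [|gam gamf] := density_probability (mu := (rho \x mu)%E) mfE f0E.
  rewrite fubini_tonelli1//.
  rewrite /fubini_F; under eq_integral do rewrite fx.
  by rewrite integral_cst// mul1e [LHS](@probability_setT _ _ _ rho).
exists gam, f; split => //; first exact: is_coupling_density gamf fx fy.
move=> z; rewrite mulrDl mul1r; apply: lerD.
  rewrite ler_piMl ?sinkhorn_density_ge0//.
  by rewrite invf_le1.
have pq0 : 0 <= q - p by rewrite subr_ge0 (le_trans p1).
apply: (@le_trans _ _ (q - p)).
  have /andP[pu _] := upq z.2.
  apply: (@le_trans _ _ ((q - p) / q)).
    by rewrite mulrBl divff ?gt_eqF// lerB// mulrC ler_wpM2l.
  by rewrite ler_pdivrMr// ler_peMr.
rewrite -mulrA ler_peMr// mulrC ler_pdivlMr ?mul1r ?sinkhorn_density_ge//.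
by rewrite exprn_gt0// divr_gt0.
Qed.

(** The full-step density is the half-step density divided by [half_marginal],
    whose values lie in [[p, q]], so the competitor has density at most c q
    with respect to the full-step coupling. The logarithms are bounded by log
    x <= x - 1 and q - 1 <= q - p. *)
Theorem sinkhorn_rate (gam : probability (X * Y)%type R) :
  is_coupling rho mu gam ->
  (forall gam' : probability (X * Y)%type R, is_coupling rho mu gam' ->
     (entropic_cost rho mu k gam <= entropic_cost rho mu k gam')%E) ->
  exists D theta : R, [/\ 0 <= D, 0 < theta < 1 &
    forall n (be be' : {measure set (X * Y) -> \bar R}),
      is_density be (rho \x mu)%E (EFin \o sinkhorn_density n.+1 n.+1) ->
      is_density be' (rho \x mu)%E (EFin \o sinkhorn_density n.+1 n.+2) ->
      (rel_entropy gam be <= (D * theta ^+ n)%:E)%E /\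
      (rel_entropy gam be' <= (D * theta ^+ n)%:E)%E].
Proof.
move=> cg opt; have [D D0 ratio] := sinkhorn_G_ratio.
set d := a / b in ratio; have d0 : 0 < d by rewrite divr_gt0.
have d1 : d < 1 by rewrite ltr_pdivrMr// mul1r.
set th := (1 - d) ^+ 2 in ratio.
exists ((1 + (d ^+ 2)^-1) * D), th.
have dV0 : 0 < (d ^+ 2)^-1 by rewrite invr_gt0 exprn_gt0.
split.
- by rewrite mulr_ge0// addr_ge0// ltW.
- by rewrite exprn_gt0 ?subr_gt0//= expr_lt1// ?subr_ge0 ?ltW// gtrBl.
move=> n be be' bed be'd; have [p [q [p0 pq qp]]] := ratio n.
have [/andP[p1 q1] [gam' [f [cg' gamf fw]]]] := sinkhorn_competitor p0 pq.
rewrite -/d in fw; set c := 1 + (q - p) / d ^+ 2 in fw.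
have e0 : 0 <= (q - p) / d ^+ 2.
  by rewrite mulr_ge0 ?subr_ge0 ?(le_trans p1)// ltW.
have c1 : 1 <= c by rewrite lerDl.
have c0 : 0 < c := lt_le_trans ltr01 c1.
have FP := sinkhorn_F_bounded n.+1; have GP := sinkhorn_GS_bounded n.
have GP' := sinkhorn_GS_bounded n.+1.
have ln_le (x : R) : 0 < x -> ln x <= x - 1.
  by move=> x0; rewrite -[in ln x](subrKC 1 x) le_ln1Dx// ltrBrDl addrN.
have bound : (1 + (d ^+ 2)^-1) * (q - p) <= (1 + (d ^+ 2)^-1) * D * th ^+ n.
  by rewrite -mulrA ler_wpM2l// addr_ge0// ltW.
have H1 := optimal_rel_entropy_le kP FP GP bed cg cg' (opt _ cg') gamf c1 fw.
have cq1 : 1 <= c * q by rewrite mulr_ege1.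
have fw' z : f z <= c * q * sinkhorn_density n.+1 n.+2 z.
  apply: le_trans (fw z) _; rewrite -mulrA ler_pM2l//.
  rewrite /sinkhorn_density [leRHS]mulrCA ler_wpM2l//.
    rewrite mulr_ge0// ltW//; first exact: bounded_positive_gt0 FP _.
    exact: bounded_positive_gt0 kP z.
  by have /andP[] := pq z.2.
have H2 := optimal_rel_entropy_le kP FP GP' be'd cg cg' (opt _ cg') gamf cq1 fw'.
have q0 : 0 < q := lt_le_trans ltr01 q1.
split; [apply: le_trans H1 _|apply: le_trans H2 _]; rewrite lee_fin;
  apply: le_trans bound.
- by have := ln_le c c0; rewrite /c; lra.
- by rewrite lnM ?posrE//; have := ln_le c c0; have := ln_le q q0; rewrite /c; lra.
Qed.

End sinkhorn_rate.

(** * Lifting to path space *)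

Section lift.
Context dO dZ (O : measurableType dO) (Z : measurableType dZ) (R : realType).
Variables (P : probability O R) (e : O -> Z).
Hypothesis me : measurable_fun setT e.
Local Open Scope ereal_scope.

(** A conditional probability of [A] given [e] is a density of this measure,
    so that uniqueness of densities applies to conditional probabilities. *)
Definition slice (Q : set O -> \bar R) (A : set O) (C : set Z) : \bar R :=
  Q (A `&` e @^-1` C).

Let me_pre C : measurable C -> measurable (e @^-1` C).
Proof. by move=> mC; rewrite -[X in measurable X]setTI; exact: me. Qed.

Lemma slice_density (Q : {measure set O -> \bar R}) (al : {measure set Z -> \bar R}) A k :
  (forall C, measurable C -> pushforward Q e C = al C) ->
  is_cond_prob Q e A k -> is_density (slice Q A) al k.
Proof.
move=> Qal [mk k0 kE]; split => // C mC; rewrite /slice kE//.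
exact: eq_integral_measure.
Qed.

Lemma slice_lty (Q : {measure set O -> \bar R}) A : measurable A ->
  Q setT < +oo -> slice Q A setT < +oo.
Proof.
move=> mA; apply: le_lt_trans; rewrite /slice preimage_setT setIT.
by rewrite le_measure// inE.
Qed.

(** The versions [k] and [k'] of the conditional probability of [A] attached
    to the two lifts are both versions of that of [P], hence agree almost
    everywhere for the image of [P], and for [al] and [be], which it
    dominates. Then Q(A) = int k d al = int k' f d be, and the right-hand side
    is the integral of f o e over A for [Qb]. *)
Lemma lift_density (al be : {finite_measure set Z -> \bar R})
    (Q Qb : {measure set O -> \bar R}) f :
  al `<< pushforward P e -> be `<< pushforward P e ->
  (forall C, measurable C -> pushforward Q e C = al C) ->
  (forall C, measurable C -> pushforward Qb e C = be C) ->
  (forall A, measurable A -> exists k, is_cond_prob P e A k /\ is_cond_prob Q e A k) ->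
  (forall A, measurable A -> exists k, is_cond_prob P e A k /\ is_cond_prob Qb e A k) ->
  is_density al be f -> is_density Q Qb (f \o e).
Proof.
move=> alP beP Qal Qbe cQ cQb af; have [mf f0 fE] := af.
pose Pe : {measure set Z -> \bar R} :=
  measure_function_pushforward__canonical__measure_function_Measure P me.
split; [exact: measurableT_comp mf me|by move=> w; exact: f0|move=> A mA].
have [k [Pk Qk]] := cQ A mA; have [k' [Pk' Qk']] := cQb A mA.
have [mk k0 _] := Pk; have [mk' k'0 _] := Pk'.
have Pfin : slice P A setT < +oo by apply: slice_lty => //; exact: probability_lty.
have kk' : ae_eq Pe setT k k'.
  by apply: (is_density_unique Pfin); exact: (@slice_density _ Pe).
have QA : Q A = \int[be]_z (k' z * f z).
  have [_ _ kE] := slice_density Qal Qk.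
  have := kE setT measurableT; rewrite /slice preimage_setT setIT => ->.
  rewrite (ae_eq_integral k')//; first exact: integral_density.
  exact: null_dominates_ae_eq alP kk'.
have sub C : slice Qb A C = pushforward (mrestr Qb mA) e C.
  by rewrite /slice /pushforward /mrestr setIC.
have := slice_density Qbe Qk'.
have -> : slice Qb A = pushforward (mrestr Qb mA) e by apply/funext.
(* The integral of f o e over A is the integral of f for the image under e of the
   restriction of Qb to A, a measure with density k' with respect to be. *)
pose nu : {measure set Z -> \bar R} :=
  measure_function_pushforward__canonical__measure_function_Measure (mrestr Qb mA) me.
move=> /(integral_density (al := nu)) => /(_ f setT measurableT mf (fun x _ => f0 x)).
rewrite ge0_integral_pushforward// preimage_setT => E.
have {}QA : Q A = \int[be]_z (f z * k' z).
  by rewrite QA; apply: eq_integral => z _; rewrite muleC.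
rewrite QA -E.
have rd : is_density (mrestr Qb mA) Qb (fun w => (\1_A w)%:E).
  split=> [||B mB]; first exact/measurable_EFinP.
  - by move=> w; rewrite lee_fin.
  - by rewrite integral_indic// setIC.
rewrite (integral_density rd); last by move=> w _; exact: f0.
2: exact: measurableT.
2: exact: measurableT_comp mf me.
rewrite [RHS]integral_mkcond; apply: eq_integral => w _.
by rewrite epatch_indic.
Qed.

Lemma rel_entropy_lift (al be : {finite_measure set Z -> \bar R})
    (Q Qb : {measure set O -> \bar R}) :
  al `<< pushforward P e -> be `<< pushforward P e ->
  (forall C, measurable C -> pushforward Q e C = al C) ->
  (forall C, measurable C -> pushforward Qb e C = be C) ->
  (forall A, measurable A -> exists k, is_cond_prob P e A k /\ is_cond_prob Q e A k) ->
  (forall A, measurable A -> exists k, is_cond_prob P e A k /\ is_cond_prob Qb e A k) ->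
  rel_entropy Q Qb = rel_entropy al be.
Proof.
move=> alP beP Qal Qbe cQ cQb.
have aloo : al setT < +oo by rewrite -ge0_fin_numE// fin_num_measure.
have Qoo : Q setT < +oo.
  by have := Qal setT measurableT; rewrite /pushforward preimage_setT => ->.
have [albe|albe] := pselect (al `<< be); last first.
  rewrite /rel_entropy; case: asboolP => [QQb|_]; last by case: asboolP.
  case: asboolP => // _; exfalso; apply: albe.
  apply/null_content_dominatesP => C mC beC.
  move/null_content_dominatesP : QQb => QQb.
  rewrite -Qal// /pushforward; apply: QQb; first exact: me_pre.
  by rewrite -[LHS]/(pushforward Qb e C) Qbe.
have [f [f0 _ fi fE]] := @radon_nikodym_sigma_finite _ _ _ be al albe.
have af : is_density al be f by split=> //; exact: measurable_int fi.
have [mf _ _] := af.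
rewrite (rel_entropy_density aloo af).
rewrite (rel_entropy_density Qoo (lift_density alP beP Qal Qbe cQ cQb af)).
have ml : measurable_fun setT (@lne R \o f).
  exact: measurableT_comp measurable_lne mf.
rewrite -(eq_integral_measure (al := pushforward Q e) (be := al))//.
rewrite integralE [RHS]integralE; congr (_ - _).
- have := @ge0_integral_pushforward _ _ _ _ _ _ me Q setT (@lne R \o f)^\+
    measurableT (measurable_funepos ml) (fun z _ => funepos_ge0 _ z).
  rewrite preimage_setT => /esym H; apply: etrans H.
  by apply: eq_integral => w _; rewrite /= !funeposE.
- have := @ge0_integral_pushforward _ _ _ _ _ _ me Q setT (@lne R \o f)^\-
    measurableT (measurable_funeneg ml) (fun z _ => funeneg_ge0 _ z).
  rewrite preimage_setT => /esym H; apply: etrans H.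
  by apply: eq_integral => w _; rewrite /= !funenegE.
Qed.

End lift.

(** * Supports *)

Section support.
Context (R : realType).

Lemma closed_msupport (T : topologicalType) (mu : set T -> \bar R) :
  closed (msupport mu).
Proof.
rewrite -[msupport mu]setCK closedC openE => x /=.
rewrite /msupport => /existsNP[U /not_implyP[oU /not_implyP[Ux U0]]].
apply: (filterS _ (open_nbhs_nbhs (conj oU Ux))) => y Uy /= H.
exact: U0 (H U oU Uy).
Qed.

Lemma open_measurable_rV n (A : set 'rV[R]_n) : open A -> measurable A.
Proof. by move=> oA; exact: sub_sigma_algebra. Qed.

Lemma closed_measurable_rV n (A : set 'rV[R]_n) : closed A -> measurable A.
Proof.
move=> cA; rewrite -[A]setCK; apply: measurableC; apply: open_measurable_rV.
exact: closed_openC.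
Qed.

(** Balls with rational centre and radius 1 / (j + 1), a countable basis of
    the topology. *)
Definition rational_ball n (q : 'rV[rat]_n * nat) : set 'rV[R]_n :=
  ball (map_mx (ratr : rat -> R) q.1 : 'rV[R]_n) (q.2.+1%:R^-1).

Lemma rational_ball_basis n (U : set 'rV[R]_n) x : open U -> U x ->
  exists q, rational_ball q x /\ rational_ball q `<=` U.
Proof.
move=> oU Ux.
have /nbhs_ballP[e /= e0 eU] : nbhs x U by exact: open_nbhs_nbhs.
have [k ke] : exists k : nat, k.+1%:R^-1 < e / 2.
  have [k _ kP] := near_infty_natSinv_lt (PosNum (divr_gt0 e0 (ltr0n R 2))).
  by exists k; apply: (kP k) => /=.
have H i j : exists q : rat, `|ratr q - x i j| < k.+1%:R^-1.
  have [|q] := @rat_in_itvoo R (x i j - k.+1%:R^-1) (x i j + k.+1%:R^-1).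
    by rewrite ltrD2l gtrN// invr_gt0.
  by rewrite in_itv/= => qP; exists q; rewrite ltr_distl.
pose Q := \matrix_(i, j) sval (cid (H i j)).
have Qx : rational_ball (Q, k) x.
  split; first by rewrite invr_gt0.
  by move=> i j; rewrite !mxE; case: cid.
exists (Q, k); split => // y Qy; apply: eU.
apply: (@le_ball _ _ x (k.+1%:R^-1 + k.+1%:R^-1)).
  by rewrite [leRHS]splitr lerD// ltW.
by apply: ball_triangle Qy; exact: ball_sym.
Qed.

(** The complement of the support is the union of the null balls of a
    countable basis. *)
Lemma msupport_compl_null n (mu : {measure set 'rV[R]_n -> \bar R}) :
  mu (~` msupport mu) = 0%E.
Proof.
(* The null balls, enumerated by the integers. *)
pose F k : set 'rV[R]_n := if @unpickle ('rV[rat]_n * nat)%type k is Some q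
  then if mu (rational_ball q) == 0%E then rational_ball q else set0
  else set0.
have mF k : measurable (F k) /\ mu (F k) = 0%E.
  rewrite /F; case: unpickle => [q|]; last by rewrite measure0.
  case: eqP => [->|_]; last by rewrite measure0.
  by split=> //; apply: open_measurable_rV; exact: ball_open.
have mS : measurable (~` msupport mu).
  by apply: measurableC; apply: closed_measurable_rV; exact: closed_msupport.
apply/eqP; rewrite -measure_le0.
have [N [mN N0 FN]] : mu.-negligible (\bigcup_k F k).
  by apply: negligible_bigcup => k; exists (F k); have [mFk Fk0] := mF k; split.
rewrite -N0 le_measure ?inE//; apply: subset_trans FN => x.
rewrite /msupport /= => /existsNP[U /not_implyP[oU /not_implyP[Ux U0]]].
have [q [qx qU]] := rational_ball_basis oU Ux.
exists (pickle q) => //; rewrite /F pickleK ifT//.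
rewrite -measure_le0 (le_trans _ (_ : mu U <= 0)%E)//.
  rewrite le_measure ?inE//; apply: open_measurable_rV => //; exact: ball_open.
by rewrite leNgt; exact/negP.
Qed.

(** A single compactness argument gives both bounds: g + 1 / g is continuous
    on [K], hence bounded. Bounds indexed by an integer are easy to make
    uniform over finitely many regimes. *)
Lemma compact_positive_bounds (V : normedModType R) (K : set V) (f g : V -> R) :
  compact K -> (forall x, K x -> {for x, continuous g}) ->
  (forall x, K x -> f x = g x) -> (forall x, K x -> 0 < f x) ->
  exists N : nat, forall x, K x -> N.+1%:R^-1 <= f x <= N.+1%:R.
Proof.
move=> cK cg fg f0.
pose h x := g x + (g x)^-1.
have ch : {within K, continuous h}.
  apply: continuous_in_subspaceT => x /set_mem Kx.
  apply: cvgD; first exact: cg.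
  by apply: cvgV; [rewrite -fg// gt_eqF// f0|exact: cg].
have [M [_ hM]] := compact_bounded (continuous_compact ch cK).
have M1 : M < `|M| + 1 by rewrite (le_lt_trans (ler_norm _))// ltrDl.
have hb x : K x -> g x + (g x)^-1 <= `|M| + 1.
  move=> Kx; apply: le_trans (ler_norm _) _.
  by apply: (hM _ M1) => /=; exists x.
pose N := Num.truncn (`|M| + 1); exists N => x Kx.
have NM : `|M| + 1 <= N.+1%:R by rewrite ltW// truncnS_gt.
have gx : 0 < g x by rewrite -fg// f0.
have gV : 0 < (g x)^-1 by rewrite invr_gt0.
rewrite fg//; apply/andP; split; last first.
  by apply: le_trans NM; apply: le_trans (hb x Kx); rewrite lerDl ltW.
rewrite -[leRHS]invrK lef_pV2 ?posrE//.
by apply: le_trans NM; apply: le_trans (hb x Kx); rewrite lerDr ltW.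
Qed.

End support.

(** * Regimes *)

Section regimes.
Context (R : realType) (d m : nat).
Local Notation E := (regime_space R d m).

Lemma measurable_fun_regime dT dU (T : measurableType dT) (U : measurableType dU)
    (e : T -> 'I_m.+1) (h : 'I_m.+1 -> T -> U) :
  measurable_fun setT e -> (forall i, measurable_fun setT (h i)) ->
  measurable_fun setT (fun t => h (e t) t).
Proof.
move=> me mh _ B mB; rewrite setTI.
rewrite (_ : _ @^-1` _ =
    \bigcup_(i in [set: 'I_m.+1]) (e @^-1` [set i] `&` h i @^-1` B)); last first.
  by apply/seteqP; split=> [t Bt|t [i _ [/= <-]]]; first by exists (e t).
apply: fin_bigcup_measurable; first exact: finite_finset.
move=> i _; apply: measurableI.
  by rewrite -[X in measurable X]setTI; exact: me.
by rewrite -[X in measurable X]setTI; exact: mh.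
Qed.

(** The part of [rho] in regime [i] is the image under the first projection of
    the restriction of [rho] to that regime. *)
Lemma regime_part_measure (rho : {measure set E -> \bar R}) i :
  exists nu : {measure set 'rV[R]_d -> \bar R},
    (forall A, nu A = regime_part rho i A) /\
    forall h : 'rV[R]_d -> \bar R, measurable_fun setT h -> (forall x, 0 <= h x)%E ->
      (\int[nu]_x h x = \int[rho]_z (h z.1 * (\1_[set i] z.2)%:E))%E.
Proof.
have mi : measurable ([set: 'rV[R]_d] `*` [set i] : set E).
  by apply: measurableX.
pose nu : {measure set 'rV[R]_d -> \bar R} :=
  measure_function_pushforward__canonical__measure_function_Measure
    (mrestr rho mi) (@measurable_fst _ _ 'rV[R]_d 'I_m.+1).
exists nu; split=> [A|h mh h0].
  rewrite /= /pushforward /mrestr /regime_part; congr (rho _).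
  by apply/seteqP; split=> -[x j] /=; tauto.
have rd : is_density (mrestr rho mi) rho (fun z => (\1_(setT `*` [set i]) z)%:E).
  split=> [||B mB]; first exact/measurable_EFinP.
  - by move=> w; rewrite lee_fin.
  - by rewrite integral_indic// setIC.
have mh1 : measurable_fun setT (h \o (@fst 'rV[R]_d 'I_m.+1)).
  exact: measurableT_comp mh measurable_fst.
rewrite (ge0_integral_pushforward (@measurable_fst _ _ 'rV[R]_d 'I_m.+1)
  (mrestr rho mi))//.
rewrite preimage_setT (integral_density rd measurableT mh1); last first.
  by move=> z _; exact: h0.
apply: eq_integral => z _ /=; congr (_ * (_)%:E)%E.
rewrite !indicE; congr (nat_of_bool _)%:R; apply/idP/idP; rewrite !inE => //.
by case.
Qed.

Lemma integral_regime_part (rho : {measure set E -> \bar R}) (h : E -> \bar R) :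
  measurable_fun setT h -> (forall z, 0 <= h z)%E ->
  (\sum_(i < m.+1) \int[regime_part rho i]_x h (x, i) = \int[rho]_z h z)%E.
Proof.
move=> mh h0.
have mhi i : measurable_fun setT (fun x => h (x, i)).
  exact: (measurableT_comp mh (measurable_pair2 i)).
transitivity (\sum_(i < m.+1) \int[rho]_z (h z * (\1_[set i] z.2)%:E))%E.
  apply: eq_bigr => i _; have [nu [nuE hE]] := regime_part_measure rho i.
  rewrite -(eq_integral_measure (al := nu)); last by move=> A _; exact: nuE.
  rewrite hE//; apply: eq_integral => -[x j] _ /=; rewrite indicE.
  have [/set_mem /= ->//|_] := boolP (j \in [set i]).
  by rewrite !mule0.
rewrite -ge0_integral_sum//.
- apply: eq_integral => -[x j] _ /=.
  rewrite (bigD1 j)//= big1 ?adde0 ?indicE ?mem_set ?mule1// => i ij.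
  rewrite indicE memNset ?mule0// => /= ji.
  by rewrite ji eqxx in ij.
- move=> i; apply: emeasurable_funM => //; apply/measurable_EFinP.
  have m1 : measurable_fun setT (\1_[set i] : 'I_m.+1 -> R) by [].
  exact: (measurableT_comp m1 (@measurable_snd _ _ 'rV[R]_d 'I_m.+1)).
- by move=> i z _; rewrite mule_ge0// lee_fin.
Qed.

Lemma measure_regime_part (rho : {measure set E -> \bar R}) (A : set E) :
  measurable A ->
  (rho A = \sum_(i < m.+1) regime_part rho i [set x | A (x, i)])%E.
Proof.
move=> mA; have mA1 : measurable_fun setT (fun z : E => (\1_A z : R)%:E).
  exact/measurable_EFinP.
have A0 (z : E) : (0 <= (\1_A z : R)%:E)%E by rewrite lee_fin.
have := integral_regime_part rho mA1 A0.
rewrite integral_indic// setIT => <-; apply: eq_bigr => i _.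
have [nu [nuE _]] := regime_part_measure rho i.
have mAi : measurable [set x : 'rV[R]_d | A (x, i)].
  by rewrite -[X in measurable X]setTI; exact: (measurable_pair2 i).
rewrite -nuE -[LHS](eq_integral_measure (al := nu)); last by move=> B _; exact: nuE.
by rewrite -[X in nu X]setIT -integral_indic.
Qed.

Variable rho : probability E R.

(** Normalization by a positive finite mass does not change the support. *)
Lemma msupport_regime_cond i : (0 < regime_mass rho i)%E ->
  msupport (regime_cond rho i) = msupport (regime_part rho i).
Proof.
move=> m0; have mfin : regime_mass rho i \is a fin_num.
  by apply: fin_num_measure; exact: measurableX.
have V0 : (0 < (regime_mass rho i)^-1)%E.
  rewrite inve_gt0//; first by rewrite gt_eqF.
  by move: mfin; rewrite fin_numE => /andP[].
have pos U : (0 < regime_cond rho i U)%E = (0 < regime_part rho i U)%E.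
  by rewrite /regime_cond muleC pmule_rgt0.
by apply/seteqP; split=> x xS U oU Ux; have := xS U oU Ux; rewrite pos.
Qed.

(** The supports of the conditional laws, over the regimes that are charged:
    the set where the kernel is controlled. *)
Definition regime_support : set E :=
  [set z | (0 < regime_mass rho z.2)%E /\ msupport (regime_cond rho z.2) z.1].

Lemma measurable_regime_support : measurable regime_support.
Proof.
rewrite (_ : regime_support = \bigcup_(i in [set i | (0 < regime_mass rho i)%E])
    (msupport (regime_cond rho i) `*` [set i])); last first.
  apply/seteqP; split=> [[x i] [/= mi xi]|[x i] [j /= mj [/= xj ->]]] //.
  by exists i.
apply: fin_bigcup_measurable; first exact: finite_finset.
move=> i _; apply: measurableX => //; apply: closed_measurable_rV.
exact: closed_msupport.
Qed.

Lemma regime_support_compl_null : rho (~` regime_support) = 0%E.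
Proof.
rewrite measure_regime_part; last exact: measurableC measurable_regime_support.
rewrite big1// => i _; have [nu [nuE _]] := regime_part_measure rho i.
have [m0|m0] := boolP (0 < regime_mass rho i)%E.
  have -> : [set x | (~` regime_support) (x, i)] = ~` msupport nu.
    apply/seteqP; split=> x; rewrite /regime_support /= msupport_regime_cond//;
      have -> : regime_part rho i = nu by apply/funext => A; rewrite nuE.
    - by move=> H xS; apply: H.
    - by move=> xS [].
  by rewrite -nuE msupport_compl_null.
have -> : [set x | (~` regime_support) (x, i)] = setT.
  by apply/seteqP; split=> // x _ [/= mi]; rewrite mi in m0.
by apply/eqP; rewrite eq_le leNgt m0/= /regime_part measure_ge0.
Qed.

(** The support of the conditional law is closed and lies in the projection of
    the compact support of [rho]. *)
Lemma compact_regime_support i : (0 < regime_mass rho i)%E ->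
  compact (msupport rho) -> compact (msupport (regime_cond rho i)).
Proof.
move=> m0 cS.
have cfst : compact ((@fst 'rV[R]_d 'I_m.+1) @` msupport rho).
  apply: continuous_compact cS; apply: continuous_subspaceT.
  by move=> z; exact: cvg_fst.
apply: (subclosed_compact (@closed_msupport _ _ _) cfst) => x.
rewrite msupport_regime_cond// => xS; exists (x, i) => // U oU Ux.
have cp j : continuous (fun y : 'rV[R]_d => (y, j) : E).
  move=> y.
  apply: (@cvg_pair _ _ _ (nbhs y) (nbhs y) (nbhs j) _ _ _ id (cst j)).
    exact: cvg_id.
  exact: cvg_cst.
have oUj j : open ((fun y : 'rV[R]_d => (y, j) : E) @^-1` U).
  by apply: open_comp => // y _; exact: cp.
have mU : measurable U.
  rewrite (_ : U = \bigcup_(j in [set: 'I_m.+1])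
      (((fun y : 'rV[R]_d => (y, j) : E) @^-1` U) `*` [set j])).
    apply: fin_bigcup_measurable; first exact: finite_finset.
    by move=> j _; apply: measurableX => //; exact: open_measurable_rV.
  apply/seteqP; split=> [[y j] Uy|[y j] [l _ [/= + ->]]] //.
  by exists j.
apply: lt_le_trans (xS _ (oUj i) Ux) _.
rewrite /regime_part le_measure ?inE//.
- by apply: measurableX => //; exact: open_measurable_rV.
- by move=> [y j] [/= Uy ->].
Qed.

End regimes.

(** * Reduction to a bounded kernel *)

Section null_complement.
Context d (T : measurableType d) (R : realType).

Lemma ae_of_null_compl (mu : {measure set T -> \bar R}) (S : set T) (Q : T -> Prop) :
  measurable S -> mu (~` S) = 0%E -> (forall x, S x -> Q x) ->
  \forall x \ae mu, Q x.
Proof.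
move=> mS S0 SQ; exists (~` S); split => //; first exact: measurableC.
by move=> x /= nQ Sx; apply: nQ; exact: SQ.
Qed.

End null_complement.

Section truncation.
Context (R : realType) (d m : nat).
Local Notation E := (regime_space R d m).
Variables (rho : probability E R) (mu : probability 'rV[R]_d R)
  (rbar : 'I_m.+1 -> 'rV[R]_d -> 'rV[R]_d -> R) (a b : R).
Hypotheses (mrbar : forall i,
    measurable_fun setT (fun z : 'rV[R]_d * 'rV[R]_d => rbar i z.1 z.2))
  (rbar_ge0 : forall i x y, 0 <= rbar i x y)
  (a_gt0 : 0 < a) (ab : a < b)
  (rbar_bounds : forall z y, regime_support rho z -> msupport mu y ->
     a <= rbar z.2 z.1 y <= b).

(** Outside the supports [rbar] may vanish or be unbounded; replacing it there
    by the constant [a] changes no integral with respect to [rho], [mu] or a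
    coupling of them, and yields a kernel with bounds that hold everywhere,
    for which the real-valued theory applies. *)
Definition truncated_kernel (z : E) (y : 'rV[R]_d) : R :=
  if (z, y) \in regime_support rho `*` msupport mu then rbar z.2 z.1 y else a.

Let measurable_good : measurable (regime_support rho `*` msupport mu).
Proof.
apply: measurableX; first exact: measurable_regime_support.
by apply: closed_measurable_rV; exact: closed_msupport.
Qed.

Lemma measurable_rbar :
  measurable_fun setT (fun z : E * 'rV[R]_d => rbar z.1.2 z.1.1 z.2).
Proof.
apply: (@measurable_fun_regime m _ _ _ _ (fun z : E * 'rV[R]_d => z.1.2)
  (fun i z => rbar i z.1.1 z.2)).
  exact: measurableT_comp measurable_snd measurable_fst.
move=> i; have mp : measurable_fun setT (fun z : E * 'rV[R]_d => (z.1.1, z.2)).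
  apply: measurable_fun_pair; last exact: measurable_snd.
  exact: measurableT_comp measurable_fst measurable_fst.
exact: (measurableT_comp (mrbar i) mp).
Qed.

Lemma measurable_truncated_kernel :
  measurable_fun setT (fun z : E * 'rV[R]_d => truncated_kernel z.1 z.2).
Proof.
apply: measurable_fun_ifT => //; last exact: measurable_rbar.
apply: (measurable_fun_bool true); rewrite setTI.
rewrite (_ : _ @^-1` _ = regime_support rho `*` msupport mu)//.
apply/seteqP; split=> [[z y] /= /set_mem//|[z y] zy /=].
by apply/mem_set.
Qed.

Lemma truncated_kernelE z y : regime_support rho z -> msupport mu y ->
  truncated_kernel z y = rbar z.2 z.1 y.
Proof. by move=> Sz Ly; rewrite /truncated_kernel mem_set. Qed.

Lemma truncated_kernel_bounds z y : a <= truncated_kernel z y <= b.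
Proof.
rewrite /truncated_kernel; case: ifPn => [/set_mem[Sz Ly]|_].
  exact: rbar_bounds.
by rewrite lexx ltW.
Qed.

Let mL : measurable (msupport mu).
Proof. by apply: closed_measurable_rV; exact: closed_msupport. Qed.

Lemma ae_mu (Q : 'rV[R]_d -> Prop) :
  (forall y, msupport mu y -> Q y) -> \forall y \ae mu, Q y.
Proof. exact: ae_of_null_compl mL (msupport_compl_null mu). Qed.

Lemma ae_rho (Q : E -> Prop) :
  (forall z, regime_support rho z -> Q z) -> \forall z \ae rho, Q z.
Proof.
exact: ae_of_null_compl (measurable_regime_support rho) (regime_support_compl_null rho).
Qed.

(** A coupling is concentrated on the product of the supports of its
    marginals. *)
Lemma ae_coupling (gam : {measure set (E * 'rV[R]_d) -> \bar R})
    (Q : E * 'rV[R]_d -> Prop) :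
  is_coupling rho mu gam ->
  (forall z y, regime_support rho z -> msupport mu y -> Q (z, y)) ->
  \forall z \ae gam, Q z.
Proof.
move=> [gA gB] SQ; apply: (ae_of_null_compl measurable_good); last first.
  by move=> [z y] [/= Sz Ly]; exact: SQ.
have mS := measurable_regime_support rho.
have H : gam.-negligible ((~` regime_support rho) `*` setT `|`
                          setT `*` (~` msupport mu)).
  apply: negligibleU.
  - exists ((~` regime_support rho) `*` setT); split => //.
      by apply: measurableX => //; exact: measurableC.
    by rewrite -(regime_support_compl_null rho); apply: gA; exact: measurableC.
  - exists (setT `*` (~` msupport mu)); split => //.
      by apply: measurableX => //; exact: measurableC.
    by rewrite -(msupport_compl_null mu); apply: gB; exact: measurableC.
apply: measure_negligible; first exact: measurableC.
apply: negligibleS H => -[z y] /= nSL.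
by have [Sz|] := pselect (regime_support rho z); [right|left];
  split => //= Ly; apply: nSL.
Qed.

Lemma is_coupling_product : is_coupling rho mu (rho \x mu)%E.
Proof.
split=> A mA; rewrite product_measure1E//.
  by rewrite [X in (_ * X)%E](@probability_setT _ _ _ mu) mule1.
by rewrite [X in (X * _)%E](@probability_setT _ _ _ rho) mul1e.
Qed.

Lemma static_objective_truncated (gam : probability (E * 'rV[R]_d)%type R) :
  is_coupling rho mu gam ->
  static_objective rbar rho mu gam = entropic_cost rho mu truncated_kernel gam.
Proof.
move=> cg; rewrite /static_objective /entropic_cost; congr (_ + _)%E.
apply: ae_eq_integral => //.
- apply: measurableT_comp => //; apply: measurableT_comp; first exact: measurable_lne.
  by apply/measurable_EFinP; exact: measurable_rbar.
- apply: measurableT_comp => //; apply: measurableT_comp; first exact: measurable_lne.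
  by apply/measurable_EFinP; exact: measurable_truncated_kernel.
- apply: (ae_coupling cg) => z y Sz Ly _ /=.
  by rewrite /projected_cost truncated_kernelE.
Qed.

Variable g0 : 'rV[R]_d -> R.
Hypotheses (mg0 : measurable_fun setT g0) (g0_gt0 : forall y, 0 < g0 y).

Local Open Scope ereal_scope.

Definition regime_sinkhorn_f (g : 'rV[R]_d -> \bar R) (z : E) : \bar R :=
  sinkhorn_f rbar mu g z.2 z.1.

Lemma measurable_sinkhorn_f g : measurable_fun setT g -> (forall y, 0 <= g y) ->
  measurable_fun setT (regime_sinkhorn_f g).
Proof.
move=> mg g_ge0; apply: measurableT_comp; first exact: measurable_inve.
apply: (measurable_fun_fubini_tonelli_F
  (fun z : E * 'rV[R]_d => (rbar z.1.2 z.1.1 z.2)%:E * g z.2)).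
- apply: emeasurable_funM.
    by apply/measurable_EFinP; exact: measurable_rbar.
  exact: measurableT_comp mg measurable_snd.
- by move=> z; rewrite mule_ge0// lee_fin.
Qed.

Lemma sinkhorn_f_ge0 g z : (forall y, 0 <= g y) -> 0 <= regime_sinkhorn_f g z.
Proof.
move=> g_ge0; rewrite inve_ge0; apply: integral_ge0 => y _.
by rewrite mule_ge0// lee_fin.
Qed.

Lemma sinkhorn_gE f y : measurable_fun setT (fun z : E => f z.2 z.1) ->
  (forall i x, 0 <= f i x) ->
  sinkhorn_g rbar rho f y =
  (\int[rho]_z ((rbar z.2 z.1 y)%:E * f z.2 z.1))^-1.
Proof.
move=> mf f0; rewrite /sinkhorn_g; congr (_ ^-1).
rewrite -(@integral_regime_part R d m rho
  (fun z => (rbar z.2 z.1 y)%:E * f z.2 z.1))//.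
- apply: emeasurable_funM => //; apply/measurable_EFinP.
  exact: (measurableT_comp measurable_rbar (measurable_pair2 y)).
- by move=> z; rewrite mule_ge0// lee_fin.
Qed.

Lemma measurable_sinkhorn_g f : measurable_fun setT (fun z : E => f z.2 z.1) ->
  (forall i x, 0 <= f i x) -> measurable_fun setT (sinkhorn_g rbar rho f).
Proof.
move=> mf f0.
have -> : sinkhorn_g rbar rho f =
    fun y => (\int[rho]_z ((rbar z.2 z.1 y)%:E * f z.2 z.1))^-1.
  by apply/funext => y; exact: sinkhorn_gE.
apply: measurableT_comp; first exact: measurable_inve.
apply: (measurable_fun_fubini_tonelli_G
  (fun z : E * 'rV[R]_d => (rbar z.1.2 z.1.1 z.2)%:E * f z.1.2 z.1.1)).
- apply: emeasurable_funM.
    by apply/measurable_EFinP; exact: measurable_rbar.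
  exact: (measurableT_comp mf measurable_fst).
- by move=> z; rewrite mule_ge0// lee_fin.
Qed.

Lemma sinkhorn_g_ge0 f y : (forall i x, 0 <= f i x) ->
  0 <= sinkhorn_g rbar rho f y.
Proof.
move=> f0; rewrite /sinkhorn_g inve_ge0.
apply: sume_ge0 => i _; have [nu [nuE _]] := regime_part_measure rho i.
rewrite -(eq_integral_measure (al := nu)); last by move=> A _; exact: nuE.
by apply: integral_ge0 => x _; rewrite mule_ge0// lee_fin.
Qed.

Lemma iterate_g_props n : measurable_fun setT (iterate_g rbar rho mu g0 n) /\
  forall y, 0 <= iterate_g rbar rho mu g0 n y.
Proof.
elim: n => [|n [mg g_ge0]].
  by split=> [|y]; [exact/measurable_EFinP|rewrite lee_fin ltW].
have f_ge0 i x : 0 <= sinkhorn_f rbar mu (iterate_g rbar rho mu g0 n) i x.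
  exact: (sinkhorn_f_ge0 (x, i)).
split; first by apply: measurable_sinkhorn_g => //; exact: measurable_sinkhorn_f.
move=> y; exact: sinkhorn_g_ge0.
Qed.

Section agreement.
Hypothesis g0P : positive_integrable mu g0.

Let k := truncated_kernel.
Let mk := measurable_truncated_kernel.
Let kb := truncated_kernel_bounds.
Let mkT : measurable_fun setT (fun z : 'rV[R]_d * E => k z.2 z.1).
Proof. exact: (measurableT_comp mk (@measurable_swap _ _ _ _)). Qed.
Let G := sinkhorn_G rho mu k g0.
Let F := sinkhorn_F rho mu k g0.

(** On the supports the extended-real iteration agrees with the real one: the
    integrands agree almost everywhere and the integrals are finite and
    positive, so that inversion is the real inversion. *)
Lemma sinkhorn_f_truncated g (g' : 'rV[R]_d -> R) z :
  measurable_fun setT g -> (forall y, 0 <= g y) ->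
  positive_integrable mu g' -> (forall y, msupport mu y -> g y = (g' y)%:E) ->
  regime_support rho z ->
  regime_sinkhorn_f g z = (schrodinger_map mu k g' z)%:E.
Proof.
move=> mg g_ge0 g'P gg' Sz; rewrite /regime_sinkhorn_f /sinkhorn_f.
have [mg' g'0 ig'] := g'P.
have ik := integrable_kernelM mk a_gt0 ab kb z ig'.
have -> : \int[mu]_y ((rbar z.2 z.1 y)%:E * g y) =
    \int[mu]_y (k z y * g' y)%:E.
  apply: ge0_ae_eq_integral => //.
  - apply: emeasurable_funM => //; apply/measurable_EFinP.
    exact: (measurableT_comp measurable_rbar (measurable_pair1 z)).
  - exact: measurable_int ik.
  - by move=> y _; rewrite mule_ge0// lee_fin.
  - move=> y _; rewrite lee_fin mulr_ge0// ?ltW//.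
    by have /andP[+ _] := kb z y; apply: lt_le_trans.
  - apply: ae_mu => y Ly _ /=.
    by rewrite gg'// EFinM /k truncated_kernelE.
rewrite -(fineK (integrable_fin_num measurableT ik)) inver ifF//.
by apply/eqP/eqP; rewrite gt_eqF//; exact: (Rintegral_kernel_gt0 mk a_gt0 ab kb z g'P).
Qed.

Lemma sinkhorn_g_truncated f (f' : E -> R) y :
  measurable_fun setT (fun z : E => f z.2 z.1) -> (forall i x, 0 <= f i x) ->
  positive_integrable rho f' ->
  (forall z, regime_support rho z -> f z.2 z.1 = (f' z)%:E) ->
  msupport mu y ->
  sinkhorn_g rbar rho f y = (schrodinger_map rho (fun y z => k z y) f' y)%:E.
Proof.
move=> mf f_ge0 f'P ff' Ly; rewrite sinkhorn_gE//.
have [mf' f'0 if'] := f'P.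
have ik := integrable_kernelM mkT a_gt0 ab (fun y z => kb z y) y if'.
have -> : \int[rho]_z ((rbar z.2 z.1 y)%:E * f z.2 z.1) =
    \int[rho]_z (k z y * f' z)%:E.
  apply: ge0_ae_eq_integral => //.
  - apply: emeasurable_funM => //; apply/measurable_EFinP.
    exact: (measurableT_comp measurable_rbar (measurable_pair2 y)).
  - exact: measurable_int ik.
  - by move=> z _; rewrite mule_ge0// lee_fin.
  - move=> z _; rewrite lee_fin mulr_ge0// ?ltW//.
    by have /andP[+ _] := kb z y; apply: lt_le_trans.
  - apply: ae_rho => z Sz _ /=.
    by rewrite ff'// EFinM /k truncated_kernelE.
rewrite -(fineK (integrable_fin_num measurableT ik)) inver ifF//.
apply/eqP/eqP; rewrite gt_eqF//.
exact: (Rintegral_kernel_gt0 mkT a_gt0 ab (fun y z => kb z y) y f'P).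
Qed.

Lemma iterate_g_truncated n y : msupport mu y ->
  iterate_g rbar rho mu g0 n y = (G n y)%:E.
Proof.
elim: n y => [//|n IH] y Ly /=.
have [mg g_ge0] := iterate_g_props n.
have GP := sinkhorn_G_positive rho mk a_gt0 ab kb g0P n.
apply: sinkhorn_g_truncated => //.
- exact: measurable_sinkhorn_f.
- by move=> i x; exact: (sinkhorn_f_ge0 (x, i)).
- exact: (sinkhorn_F_positive rho mk a_gt0 ab kb g0P n).
- by move=> z Sz; exact: sinkhorn_f_truncated.
Qed.

Lemma iterate_fS_truncated n z : regime_support rho z ->
  iterate_fS rbar rho mu g0 n z.2 z.1 = (F n z)%:E.
Proof.
move=> Sz; have [mg g_ge0] := iterate_g_props n.
apply: (sinkhorn_f_truncated (z := z)) => //.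
- exact: (sinkhorn_G_positive rho mk a_gt0 ab kb g0P n).
- by move=> y; exact: iterate_g_truncated.
Qed.

Lemma coupling_of_density n n' :
  is_density (coupling_of rbar rho mu (iterate_fS rbar rho mu g0 n)
      (iterate_g rbar rho mu g0 n'))
    (rho \x mu) (EFin \o sinkhorn_density rho mu k g0 n n').
Proof.
have mw := measurable_sinkhorn_density rho mk a_gt0 ab kb g0P n n'.
have w0 z := sinkhorn_density_ge0 rho mk a_gt0 ab kb g0P n n' z.
have [mg g_ge0] := iterate_g_props n.
have [mg' g'_ge0] := iterate_g_props n'.
split => [||C mC]; first by apply/measurable_EFinP.
  by move=> z; rewrite lee_fin.
apply: ge0_ae_eq_integral => //.
- apply: measurable_funTS; apply: emeasurable_funM; first apply: emeasurable_funM.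
  + exact: (measurableT_comp (measurable_sinkhorn_f mg g_ge0) measurable_fst).
  + by apply/measurable_EFinP; exact: measurable_rbar.
  + exact: (measurableT_comp mg' measurable_snd).
- by apply: measurable_funTS; apply/measurable_EFinP.
- move=> z _; rewrite !mule_ge0// ?lee_fin//.
  exact: (sinkhorn_f_ge0 z.1).
- by move=> z _; rewrite lee_fin.
- apply: (ae_coupling is_coupling_product) => z y Sz Ly _ /=.
  rewrite iterate_fS_truncated// iterate_g_truncated//.
  by rewrite /sinkhorn_density/= -!EFinM /k truncated_kernelE.
Qed.

End agreement.

(** If [g0] were not integrable, the lower bound on the kernel would make the
    integrals defining f^1 infinite on the support, so that f^1, and with it
    the measure gamma^{1,0}, would be zero; it could then not dominate [gam]. *)
Lemma half_coupling0_finite (gam : probability (E * 'rV[R]_d)%type R) :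
  rel_entropy gam (half_coupling rbar rho mu g0 0) < +oo ->
  positive_integrable mu g0.
Proof.
move=> fin; split => //; apply/integrableP; split; first exact/measurable_EFinP.
under eq_integral do rewrite gee0_abs ?lee_fin ?(ltW (g0_gt0 _))//.
rewrite ltNge leye_eq; apply/negP => /eqP Ioo.
have f0 z : regime_support rho z -> regime_sinkhorn_f (EFin \o g0) z = 0.
  move=> Sz; apply/eqP; rewrite inve_eq0 -leye_eq.
  rewrite -(gt0_mulye (x := a%:E)) ?lte_fin// muleC -Ioo.
  rewrite -ge0_integralZl//; last 3 first.
  - exact/measurable_EFinP.
  - by move=> y _; rewrite lee_fin ltW.
  - by rewrite lee_fin ltW.
  apply: ae_ge0_le_integral => //.
  - by move=> y _; rewrite mule_ge0// lee_fin ltW.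
  - by apply: emeasurable_funM => //; exact/measurable_EFinP.
  - by move=> y _; rewrite mule_ge0// lee_fin// ltW.
  - apply: emeasurable_funM; last exact/measurable_EFinP.
    apply/measurable_EFinP.
    exact: (measurableT_comp measurable_rbar (measurable_pair1 z)).
  - apply: ae_mu => y Ly _ /=; rewrite -!EFinM lee_fin ler_wpM2r ?(ltW (g0_gt0 y))//.
    by have /andP[] := rbar_bounds Sz Ly.
have mg0E : measurable_fun setT (EFin \o g0) by exact/measurable_EFinP.
have g0_ge0E y : 0 <= (EFin \o g0) y by rewrite lee_fin ltW.
have half0 C : measurable C -> half_coupling rbar rho mu g0 0 C = 0.
  move=> mC; rewrite /half_coupling /coupling_of.
  rewrite -(integral0 (rho \x mu) C); apply: ge0_ae_eq_integral => //.
  - apply: measurable_funTS; apply: emeasurable_funM; first apply: emeasurable_funM.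
    + exact: (measurableT_comp (measurable_sinkhorn_f mg0E g0_ge0E) measurable_fst).
    + by apply/measurable_EFinP; exact: measurable_rbar.
    + exact: (measurableT_comp mg0E measurable_snd).
  - move=> z _; rewrite !mule_ge0// ?lee_fin ?(ltW (g0_gt0 _))//.
    exact: (sinkhorn_f_ge0 z.1).
  - apply: (ae_coupling is_coupling_product) => z y Sz Ly _ /=.
    by rewrite [iterate_fS _ _ _ _ _ _ _](f0 z Sz) !mul0e.
move: fin; rewrite /rel_entropy; case: asboolP => // dom _.
have : gam setT = 0.
  by apply: (dom setT) => // A mA _; exact: half0.
by move/eqP; rewrite probability_setT onee_eq0.
Qed.

End truncation.

(** * The reference process and the theorem *)

Section reference.
Context (R : realType) (d m : nat).

Lemma kernel_bounds (rho : probability (regime_space R d m) R)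
    (mu : probability 'rV[R]_d R) (rbar : 'I_m.+1 -> 'rV[R]_d -> 'rV[R]_d -> R) :
  compact (msupport rho) -> compact (msupport mu) ->
  (forall i, (0 < regime_mass rho i)%E ->
      of_class_C2_on (msupport (regime_cond rho i) `*` msupport mu)
        (fun z => rbar i z.1 z.2) /\
      forall x y, msupport (regime_cond rho i) x -> msupport mu y ->
        0 < rbar i x y) ->
  exists a b : R, [/\ 0 < a, a < b & forall z y, regime_support rho z ->
    msupport mu y -> a <= rbar z.2 z.1 y <= b].
Proof.
move=> crho cmu smooth.
have /choice[N NP] : forall i, exists N : nat, (0 < regime_mass rho i)%E ->
    forall x y, msupport (regime_cond rho i) x -> msupport mu y ->
    N.+1%:R^-1 <= rbar i x y <= N.+1%:R.
  move=> i; have [mi|mi] := pselect (0 < regime_mass rho i)%E; last by exists 0%N.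
  have [[U [G [oU KU [G0 _ _] FG]]] pos] := smooth i mi.
  have cK := compact_setX (compact_regime_support mi crho) cmu.
  have [||x [xS yS]|N NP] :=
    compact_positive_bounds (f := fun z => rbar i z.1 z.2) (g := G) cK.
  - by move=> z Kz; apply: G0; exact: KU.
  - by move=> z Kz; exact/FG/mem_set.
  - exact: pos.
  - by exists N => _ x y xS yS; exact: (NP (x, y)).
pose M := (\max_i N i)%N.
exists (M.+1%:R^-1), (M.+1%:R + 1); split => //.
- apply: (@le_lt_trans _ _ 1); first by rewrite invf_le1// ler1n.
  by rewrite ltrDr.
move=> [x i] y [/= mi xS] yS; have /andP[lo hi] := NP i mi x y xS yS.
have NM : (N i <= M)%N by exact: leq_bigmax.
apply/andP; split.
  by apply: le_trans lo; rewrite lef_pV2 ?posrE// ler_nat.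
by apply: le_trans hi _; rewrite -[leLHS]addr0 lerD// ler_nat.
Qed.

Lemma measurable_path_Z (T : R) t : 0 <= t <= T ->
  measurable_fun [set: path_space T d m] (@path_Z R T d m t).
Proof.
move=> tT _ B mB; rewrite setTI; apply: sub_sigma_algebra.
by exists t; [rewrite /= in_itv|exists B].
Qed.

Lemma measurable_endpoints (T : R) : 0 <= T ->
  measurable_fun setT (@endpoints R T d m).
Proof.
move=> T0; apply: measurable_fun_pair.
  by apply: measurable_path_Z; rewrite lexx.
apply: (measurableT_comp (@measurable_fst _ _ _ _)
  (measurable_path_Z (t := T) _)).
by rewrite lexx T0.
Qed.

End reference.

Theorem theorem2p21 (R : realType) (T : R) (d m : nat)
    (T_gt0 : 0 < T) (d_ge1 : (1 <= d)%N)
    (b : 'I_m.+1 -> R -> 'rV[R]_d -> 'rV[R]_d)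
    (sigma : 'I_m.+1 -> R -> 'rV[R]_d -> 'M[R]_d)
    (lambda : 'I_m.+1 -> 'I_m.+1 -> R -> 'rV[R]_d -> R)
    (P : probability (path_space T d m) R)
    (P_reference : is_reference_law b sigma lambda P)
    (rho : probability (regime_space R d m) R)
    (mu : probability 'rV[R]_d R)
    (r : 'I_m.+1 -> 'I_m.+1 -> 'rV[R]_d -> 'rV[R]_d -> R)
    (rbar := projected_density r)
    (P0T := pushforward P (@endpoints R T d m))
    (entropy_finite : (rel_entropy (rho \x mu) P0T < +oo)%E)
    (P0T_dominated :
      (fun C => P0T (C `&` msupport (rho \x mu)%E)) `<< (rho \x mu)%E)
    (marginals_ac : forall i, (0 < regime_mass rho i)%E ->
      regime_cond rho i `<< @lebesgue_rV R d /\ mu `<< @lebesgue_rV R d)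
    (rho_compact : compact (msupport rho))
    (mu_compact : compact (msupport mu))
    (C_mu : R) (C_mu_gt0 : 0 < C_mu)
    (transport_entropy : forall eta : probability 'rV[R]_d R,
      (W2 eta mu ^+ 2 <= C_mu%:E * rel_entropy eta mu)%E)
    (r_density : is_transition_density P r)
    (rbar_smooth : forall i, (0 < regime_mass rho i)%E ->
      of_class_C2_on (msupport (regime_cond rho i) `*` msupport mu)
        (fun z => rbar i z.1 z.2) /\
      forall x y, msupport (regime_cond rho i) x -> msupport mu y ->
        0 < rbar i x y)
    (gam : probability (regime_space R d m * 'rV[R]_d)%type R)
    (gam_optimal : is_optimal_coupling rbar rho mu gam)
    (g0 : 'rV[R]_d -> R)
    (g0_measurable : measurable_fun [set: 'rV[R]_d] g0)
    (g0_gt0 : forall y, 0 < g0 y)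
    (half := half_coupling rbar rho mu g0)
    (full := full_coupling rbar rho mu g0)
    (half0_finite : (rel_entropy gam (half 0%N) < +oo)%E)
    (full0_finite : (rel_entropy gam (full 0%N) < +oo)%E) :
  exists (A theta : R),
    [/\ 0 < A, 0 < theta < 1,
        (forall n : nat,
           (rel_entropy gam (half n) <= (A * theta ^+ n)%:E)%E /\
           (rel_entropy gam (full n) <= (A * theta ^+ n)%:E)%E) &
        forall (Q : {measure set (path_space T d m) -> \bar R})
          (Qhalf Qfull : nat -> {measure set (path_space T d m) -> \bar R}),
          is_lift P gam Q ->
          (forall n, is_lift P (half n) (Qhalf n)) ->
          (forall n, is_lift P (full n) (Qfull n)) ->
          forall n : nat,
            [/\ rel_entropy Q (Qhalf n) = rel_entropy gam (half n),
                rel_entropy Q (Qfull n) = rel_entropy gam (full n),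
                (rel_entropy Q (Qhalf n) <= (A * theta ^+ n)%:E)%E &
                (rel_entropy Q (Qfull n) <= (A * theta ^+ n)%:E)%E]].
Proof.
have [lo [hi [lo_gt0 lohi bounds]]] := kernel_bounds rho_compact mu_compact rbar_smooth.
have mrbar i : measurable_fun setT (fun z : 'rV[R]_d * 'rV[R]_d => rbar i z.1 z.2).
  by apply: measurable_sum => j; have [] := r_density i j.
have rbar_ge0 i x y : 0 <= rbar i x y.
  by apply: sumr_ge0 => j _; have [] := r_density i j.
have g0P : positive_integrable mu g0.
  exact: (half_coupling0_finite mrbar rbar_ge0 lo_gt0 bounds g0_measurable
    g0_gt0 half0_finite).
set k := truncated_kernel rho mu rbar lo.
have mk := measurable_truncated_kernel rho mu lo mrbar.
have kb := truncated_kernel_bounds lohi bounds.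
have [cg opt] := gam_optimal.
have opt' (gam' : probability (regime_space R d m * 'rV[R]_d)%type R) :
    is_coupling rho mu gam' ->
    (entropic_cost rho mu k gam <= entropic_cost rho mu k gam')%E.
  move=> cg'; rewrite -!(static_objective_truncated lo mrbar)//.
  by have [] := opt gam' cg'.
pose pi : probability (regime_space R d m * 'rV[R]_d)%type R := (rho \x mu)%E.
pose w n n' := sinkhorn_density rho mu k g0 n n'.
have mw n n' : measurable_fun setT (EFin \o w n n').
  apply/measurable_EFinP.
  exact: (measurable_sinkhorn_density rho mk lo_gt0 lohi kb g0P).
have w0 n n' z : (0 <= (EFin \o w n n') z)%E.
  by rewrite lee_fin; exact: (sinkhorn_density_ge0 rho mk lo_gt0 lohi kb g0P).
have entE (bec : set (regime_space R d m * 'rV[R]_d) -> \bar R)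
    (be : probability (regime_space R d m * 'rV[R]_d)%type R) :
    (forall C, measurable C -> bec C = be C) ->
    rel_entropy gam bec = rel_entropy gam be.
  by move=> becE; apply: eq_rel_entropy.
have halfP n : exists be : probability (regime_space R d m * 'rV[R]_d)%type R,
    is_density be pi (EFin \o w n n) /\ forall C, measurable C -> half n C = be C.
  have [be bed] := density_probability (mw n n) (w0 n n)
    (integral_sinkhorn_half rho mk lo_gt0 lohi kb g0P n).
  exists be; split => // C mC; have [_ _ beE] := bed.
  have [_ _ cE] := coupling_of_density mrbar rbar_ge0 lo_gt0 lohi bounds
    g0_measurable g0_gt0 g0P n n.
  by rewrite beE//; exact: cE.
have fullP n : exists be : probability (regime_space R d m * 'rV[R]_d)%type R,
    is_density be pi (EFin \o w n n.+1) /\ forall C, measurable C -> full n C = be C.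
  have [be bed] := density_probability (mw n n.+1) (w0 n n.+1)
    (integral_sinkhorn_full rho mk lo_gt0 lohi kb g0P n).
  exists be; split => // C mC; have [_ _ beE] := bed.
  have [_ _ cE] := coupling_of_density mrbar rbar_ge0 lo_gt0 lohi bounds
    g0_measurable g0_gt0 g0P n n.+1.
  by rewrite beE//; exact: cE.
(* From here on the two couplings are known through halfP and fullP only. *)
clearbody half full.
have [D [th [D0 /andP[th0 th1] rate]]] := sinkhorn_rate mk lo_gt0 lohi kb g0P cg opt'.
have lt_bound (x : \bar R) : (x < +oo)%E -> exists2 c : R, 0 <= c & (x <= c%:E)%E.
  case: x => [x _||_]; [by exists `|x|; rewrite ?lee_fin ?ler_norm|by rewrite ltxx|].
  by exists 0; rewrite ?leNye.
have [A0 A0_ge0 half_A0] := lt_bound _ half0_finite.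
have [A1 A1_ge0 full_A1] := lt_bound _ full0_finite.
(* The rate starts at n = 1, hence the division by th; the term 1 makes the
   constant positive. *)
pose A := A0 + A1 + D / th + 1.
have Dth : 0 <= D / th by rewrite divr_ge0// ltW.
have A_gt0 : 0 < A by rewrite ltr_wpDl// !addr_ge0.
have A0A : A0 <= A by rewrite /A -!addrA lerDl !addr_ge0.
have A1A : A1 <= A by rewrite /A -!addrA addrCA lerDl !addr_ge0.
have DA : D / th <= A by rewrite /A -addrA addrCA lerDl !addr_ge0.
have rates n : (rel_entropy gam (half n) <= (A * th ^+ n)%:E)%E /\
    (rel_entropy gam (full n) <= (A * th ^+ n)%:E)%E.
  case: n => [|n].
    rewrite expr0 mulr1; split; [apply: le_trans half_A0 _|apply: le_trans full_A1 _];
      by rewrite lee_fin.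
  have [be [bed beE]] := halfP n.+1; have [be' [be'd be'E]] := fullP n.+1.
  rewrite (entE _ _ beE).
  rewrite (entE _ _ be'E).
  have [H1 H2] := rate n be be' bed be'd.
  have DAn : ((D * th ^+ n)%:E <= (A * th ^+ n.+1)%:E)%E.
    rewrite lee_fin exprS mulrA ler_wpM2r ?exprn_ge0 ?(ltW th0)//.
    by rewrite -ler_pdivrMr.
  by split; [exact: le_trans H1 DAn|exact: le_trans H2 DAn].
exists A, th; split => //; first by rewrite th0.
move=> Q Qhalf Qfull [QE Qcond] liftH liftF n.
have me := @measurable_endpoints R d m T (ltW T_gt0).
(* A finite relative entropy implies absolute continuity. *)
have pi_P0T : pi `<< P0T.
  by move: entropy_finite; rewrite /rel_entropy; case: asboolP.
have dom (be : probability (regime_space R d m * 'rV[R]_d)%type R) f :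
    is_density be pi f -> be `<< P0T.
  by move=> bed; apply: null_dominates_trans (is_density_dominates bed) pi_P0T.
have gamP0T : gam `<< P0T.
  have [be [bed beE]] := halfP 0%N.
  move: half0_finite; rewrite (entE _ _ beE) /rel_entropy.
  case: asboolP => // gbe _; exact: null_dominates_trans gbe (dom be _ bed).
have lift (be : probability (regime_space R d m * 'rV[R]_d)%type R) f
    (Qb : {measure set (path_space T d m) -> \bar R})
    (bec : set (regime_space R d m * 'rV[R]_d) -> \bar R) :
    is_density be pi f -> (forall C, measurable C -> bec C = be C) ->
    is_lift P bec Qb -> rel_entropy Q Qb = rel_entropy gam bec.
  move=> bed becE [QbE Qbcond].
  rewrite (entE _ _ becE).
  apply: (rel_entropy_lift me gamP0T (dom be f bed)) => //.
  by move=> C mC; rewrite QbE// becE.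
have [beh [behd behE]] := halfP n; have [bef [befd befE]] := fullP n.
have LH := lift beh _ (Qhalf n) (half n) behd behE (liftH n).
have LF := lift bef _ (Qfull n) (full n) befd befE (liftF n).
have [half_le full_le] := rates n.
by split; [exact: LH|exact: LF|rewrite LH|rewrite LF].
Qed.
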